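(* There is a deterministic algorithm in the Congested Clique model that solves the Spanning Forest problem on an arbitrary $n$-vertex input graph $G$ with $m$ edges in $\mathcal{O}(1)$ rounds, using $\mathcal{O}(m)$ communication.
   Context: Congested Clique model: there are $n$ players (processors), each corresponding to one vertex of an $n$-vertex input graph $G$; initially each player knows the edges incident to its vertex. Computation proceeds in synchronous rounds; in each round every player performs arbitrary local computation, and then every pair of players can exchange one message of $\mathcal{O}(\log n)$ bits in each direction. Spanning Forest problem: compute a set of edges of $G$ forming a forest that contains a spanning tree of each connected component of $G$ (known by some player at the end). Communication is measured as the number of messages sent, where messages delivered via Lenzen's deterministic $\mathcal{O}(1)$-round routing protocol (which delivers any set of messages in which every player is the source and destination of $\mathcal{O}(n)$ messages) are counted as the messages themselves, without the overhead of the routing protocol; ''using $\mathcal{O}(m)$ communication'' means that in each round each player sends and receives $\mathcal{O}(n)$ messages and the total number of messages is $\mathcal{O}(m)$. *)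

(* Defs.v *)
From HB Require Import structures.
From mathcomp Require Import all_boot.

Set Implicit Arguments.
Unset Strict Implicit.
Unset Printing Implicit Defensive.

Record sgraph (n : nat) := SGraph {
  adj :> rel 'I_n;
  adj_sym : symmetric adj;
  adj_irr : irreflexive adj
}.

(** An undirected edge is the set of its two endpoints. *)
Definition edges n (G : sgraph n) : {set {set 'I_n}} :=
  [set [set p.1; p.2] | p : 'I_n * 'I_n & G p.1 p.2].

Definition edge_rel n (F : {set {set 'I_n}}) : rel 'I_n :=
  [rel x y | (x != y) && ([set x; y] \in F)].

(** [cycle] also accepts [[::]] and, for a symmetric relation, the
    back-and-forth walk [[:: x; y]]; graph cycles have at least 3 vertices. *)
Definition acyclic n (F : {set {set 'I_n}}) : Prop :=
  forall c : seq 'I_n, uniq c -> cycle (edge_rel F) c -> size c <= 2.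

Definition component n (G : sgraph n) (x : 'I_n) : {set 'I_n} :=
  [set y | connect G x y].

Definition spanning_tree n (G : sgraph n) (K : {set 'I_n})
    (T : {set {set 'I_n}}) : Prop :=
  [/\ T \subset edges G,
      forall A, A \in T -> A \subset K,
      acyclic T
    & {in K &, forall x y, connect (edge_rel T) x y}].

Definition spanning_forest n (G : sgraph n) (F : {set {set 'I_n}}) : Prop :=
  [/\ F \subset edges G,
      acyclic F
    & forall x, exists2 T : {set {set 'I_n}},
        T \subset F & spanning_tree G (component G x) T].

Definition message := bitseq.

(** [Exchange] is a plain round of the clique. [Route] is an invocation of
    Lenzen's routing protocol, used as a black box. *)
Inductive phase := Exchange | Route.

(** A deterministic algorithm for [n] players. Local computation is
    unrestricted: the local states form an arbitrary type, and the transitions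
    are arbitrary functions. Player [v] starts from its own name and the
    neighbourhood of its vertex; [send k v s w] lists the messages that [v], in
    local state [s], addresses to [w] in phase [k]; [receive k v s inbox] is its
    next state, where [inbox u] lists the messages from [u]. At the end a player
    may claim to know the answer ([Some F]) or not ([None]). *)
Record algorithm (n : nat) := Algorithm {
  state : Type;
  init : 'I_n -> {set 'I_n} -> state;
  schedule : seq phase;
  send : nat -> 'I_n -> state -> 'I_n -> seq message;
  receive : nat -> 'I_n -> state -> ('I_n -> seq message) -> state;
  output : 'I_n -> state -> option {set {set 'I_n}}
}.

Section Execution.
Variables (n : nat) (P : algorithm n) (G : sgraph n).

(** Local states of all players before phase [k]. *)
Fixpoint config (k : nat) : 'I_n -> state P :=
  if k is k'.+1 then
    fun v => receive k' v (config k' v) (fun u => send k' u (config k' u) v)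
  else fun v => init P v [set w | G v w].

Definition sent (k : nat) (u v : 'I_n) : seq message :=
  send k u (config k u) v.

Definition final_output (v : 'I_n) : option {set {set 'I_n}} :=
  output v (config (size (schedule P)) v).

(** The admissible communication in phase [k], on input [G]: messages have at
    most [B * log n] bits, and every player sends and receives at most [C * n]
    of them; moreover, in a plain round there is at most one message per
    ordered pair of players. *)
Definition admissible (B C k : nat) : Prop :=
  [/\ forall v, sent k v v = [::],
      forall u v msg, msg \in sent k u v -> size msg <= B * trunc_log 2 n,
      forall u, \sum_(v < n) size (sent k u v) <= C * n,
      forall v, \sum_(u < n) size (sent k u v) <= C * n
    & nth Route (schedule P) k = Exchange ->
        forall u v, size (sent k u v) <= 1].

(** Messages handed over to the routing protocol are counted as such, without
    the overhead of the protocol. *)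
Definition communication : nat :=
  \sum_(k < size (schedule P)) \sum_(u < n) \sum_(v < n) size (sent k u v).

(** Some player knows a spanning forest, and no player claims a wrong one. *)
Definition solves_spanning_forest : Prop :=
  (exists v F, final_output v = Some F) /\
  (forall v F, final_output v = Some F -> spanning_forest G F).

End Execution.

(** [lenzen C] is the number of rounds that the routing protocol takes when
    every player is the source and the destination of at most [C * n]
    messages. *)
Definition rounds (lenzen : nat -> nat) (C n : nat) (P : algorithm n) : nat :=
  \sum_(p <- schedule P) (if p is Route then lenzen C else 1).

(* Main.v *)
Require Import Defs.
From HB Require Import structures.
From mathcomp Require Import all_boot zify.
From Stdlib Require Import FunctionalExtensionality.

Set Implicit Arguments.
Unset Strict Implicit.
Unset Printing Implicit Defensive.

(** Split the vertices into classes by degree, class [i] being the vertices of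
    degree between [4 ^ i] and [4 ^ i.+1]. A probabilistic argument gives, for
    each [i], a family of about [4 ^ i * log n] vertex sets of size
    [O(n / 2 ^ i)] such that every set of [4 ^ i] vertices meets all but a
    fraction [O(1 / 2 ^ i)] of them. A vertex of class [i] tells [4 ^ i] players
    which of these sets its neighbourhood misses (a message holds one bit for
    each of [log n] sets), so that a set missed by only [O(n / 2 ^ i)]
    vertices of the class is found. If every vertex points to a neighbour in the
    set chosen for its class and the pointers are contracted, then for every [i]
    only [O(n / 2 ^ i)] supernodes contain vertices of class at least [i].

    Assign each edge to its endpoint of smaller class. Gathering the edges of
    class [i] in batches of [O(n)] and keeping only a spanning forest on the
    supernodes of each batch divides their number by [2 ^ i]. There are at most
    [4 * 4 ^ i] edges per vertex of the class, so after two such steps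
    [O(n)] edges are left in total, and one player can collect them. *)

(** * Dispersing families of sets *)

(** Bernoulli's inequality with base [n - d] and exponent [n %/ d + 1], whose product with [d]
    exceeds [n]. In probabilistic terms, [n %/ d + 1] uniform vertices all miss a fixed set of [d]
    vertices with probability at most 1/2. *)
Lemma double_exp_sub (n d : nat) :
  0 < d <= n -> 2 * (n - d) ^ (n %/ d).+1 <= n ^ (n %/ d).+1.
Proof.
case/andP=> d_gt0 le_dn.
have bern a q : a ^ q.+1 + q.+1 * d * a ^ q <= (a + d) ^ q.+1.
  elim: q => [|q IHq]; first by rewrite !expn1 expn0; lia.
  rewrite [(a + d) ^ _]expnS; apply: leq_trans (leq_mul (leqnn (a + d)) IHq).
  rewrite !expnS; nia.
have := bern (n - d) (n %/ d); rewrite subnK //; apply: leq_trans.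
rewrite mul2n -addnn leq_add2l expnS leq_mul2r.
by rewrite (leq_trans (leq_subr _ _)) ?orbT // ltnW // ltn_ceil.
Qed.

Lemma bin_le_expn (n d : nat) : 'C(n, d) <= n ^ d.
Proof.
apply: (@leq_trans (n ^_ d)); first by rewrite -bin_ffact leq_pmulr ?fact_gt0.
by elim: d => // d IHd; rewrite ffactnSr expnSr leq_mul ?leq_subr.
Qed.

(** The numerator of a probability: [f] draws [s] independent vertices for each [x : T], and only
    the draws for members of [R] are restricted. *)
Lemma card_avoiding (n s : nat) (T : finType) (A : {set 'I_n}) (R : {set T}) :
  #|[set f : {ffun T * 'I_s -> 'I_n} |
      [forall p : T * 'I_s, (p.1 \in R) ==> (f p \notin A)]]| =
  (n - #|A|) ^ (s * #|R|) * n ^ (s * (#|T| - #|R|)).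
Proof.
pose F (p : T * 'I_s) : pred 'I_n :=
  if p.1 \in R then [pred y | y \notin A] else predT.
have -> : #|[set f : {ffun T * 'I_s -> 'I_n} |
      [forall p : T * 'I_s, (p.1 \in R) ==> (f p \notin A)]]| = #|family F|.
  apply: eq_card => f; rewrite !inE; apply/forallP/familyP => H p; move: (H p);
  by rewrite /F; case: (p.1 \in R).
rewrite card_family foldrE big_map big_enum /=.
rewrite (bigID (fun p : T * 'I_s => p.1 \in R)) /=.
have -> : \prod_(p : T * 'I_s | p.1 \in R) #|F p| = \prod_(p in setX R [set: 'I_s]) (n - #|A|).
  apply: eq_big => [p|p pR]; first by rewrite !inE andbT.
  have -> : #|F p| = #|[predC A]| by rewrite /F pR; apply: eq_card => y; rewrite !inE.
  by have := cardC A; rewrite card_ord; lia.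
have -> : \prod_(p : T * 'I_s | p.1 \notin R) #|F p| = \prod_(p in setX (~: R) [set: 'I_s]) n.
  apply: eq_big => [p|p /negbTE pR]; first by rewrite !inE andbT.
  by rewrite /F pR cardT size_enum_ord.
rewrite !prod_nat_const !cardsX cardsT card_ord; rewrite !(mulnC _ s).
by have <- := cardsC R; rewrite addKn.
Qed.

(* Probabilistic method: [S x] is a tuple of uniformly random vertices. At most
   [2 ^ (2 * #|D|)] pairs (A, R) can witness a failure (A is missed by all
   [S x], x in R), each with probability less than [2 ^ - (2 * #|D|)]. *)
Lemma exists_disperser (n d t : nat) (T : finType) (D : {set T}) :
  0 < d <= n -> n ^ d <= 2 ^ #|D| ->
  exists S : {ffun T -> {set 'I_n}},
    [forall x, #|S x| <= (n %/ d).+1 * t] &&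
    [forall A : {set 'I_n}, (d <= #|A|) ==>
       (t * #|[set x in D | [disjoint S x & A]]| <= 2 * #|D|)].
Proof.
move=> dn le_nD; have [d_gt0 le_dn] := andP dn.
(* Each of [t] groups of [n %/ d + 1] draws misses a given [d]-set with probability at most 1/2, so
   all [s] draws miss it with probability at most [2 ^ - t]. *)
set s := _ * t.
pose bad (AR : {set 'I_n} * {set T}) := [set f : {ffun T * 'I_s -> 'I_n} |
      [forall p : T * 'I_s, (p.1 \in AR.2) ==> (f p \notin AR.1)]].
pose P := [set AR : {set 'I_n} * {set T} |
   (#|AR.1| == d) && (AR.2 \subset D) && (2 * #|D| < t * #|AR.2|)].
have badP AR : AR \in P -> 2 ^ (2 * #|D|).+1 * #|bad AR| <= n ^ (s * #|T|).
  case: AR => A R; rewrite inE /= => /andP[/andP[/eqP cA _] tR].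
  rewrite card_avoiding cA.
  have -> : s * #|T| = s * #|R| + s * (#|T| - #|R|).
    by rewrite -mulnDr subnKC // max_card.
  rewrite expnD mulnA leq_mul2r; apply/orP; right.
  apply: (@leq_trans (2 ^ (t * #|R|) * (n - d) ^ (s * #|R|))).
    by rewrite leq_mul2r leq_exp2l // tR orbT.
  rewrite /s -mulnA !(expnM _ _ (t * _)) -expnMn leq_exp2r; first exact: double_exp_sub.
  by lia.
have cP : #|P| <= 2 ^ (2 * #|D|).
  apply: (@leq_trans #|setX [set A : {set 'I_n} | #|A| == d] (powerset D)|).
    apply: subset_leq_card; apply/subsetP => -[A R]; rewrite !inE /=.
    by case/andP.
  rewrite cardsX card_draws card_powerset card_ord mul2n -addnn expnD.
  by rewrite leq_mul2r (leq_trans (bin_le_expn _ _)) ?orbT.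
have ltU : #|\bigcup_(AR in P) bad AR| < #|[set: {ffun T * 'I_s -> 'I_n}]|.
  have n_gt0 : 0 < n by lia.
  have -> : #|[set: {ffun T * 'I_s -> 'I_n}]| = n ^ (s * #|T|).
    by rewrite cardsT card_ffun card_ord card_prod card_ord mulnC.
  have leU : #|\bigcup_(AR in P) bad AR| <= \sum_(AR in P) #|bad AR|.
    elim/big_rec2: _ => [|AR m U _ IH]; first by rewrite cards0.
    by rewrite (leq_trans (leq_card_setU _ _)) // leq_add2l.
  apply: leq_ltn_trans leU _.
  have pos : 0 < n ^ (s * #|T|) by rewrite expn_gt0 n_gt0.
  rewrite -(ltn_pmul2l (_ : 0 < 2 ^ (2 * #|D|).+1)) ?expn_gt0 //.
  rewrite big_distrr /=; apply: (@leq_ltn_trans (#|P| * n ^ (s * #|T|))).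
    by rewrite -sum_nat_const leq_sum.
  rewrite ltn_pmul2r //; apply: leq_ltn_trans cP _.
  by rewrite ltn_exp2l.
have /subsetPn[f _ fU] : ~~ ([set: {ffun T * 'I_s -> 'I_n}] \subset \bigcup_(AR in P) bad AR).
  by apply: contraL ltU => /subset_leq_card; rewrite -leqNgt.
exists [ffun x => [set f (x, j) | j : 'I_s]]; apply/andP; split.
  apply/forallP => x; rewrite ffunE (leq_trans (leq_imset_card _ _)) //.
  by rewrite cardT size_enum_ord.
apply/forallP => A; apply/implyP => le_dA.
rewrite leqNgt; apply: contra fU => tR.
(* The union bound runs over sets of exactly [d] vertices; a larger [A] is cut down to such a [B],
   which is missed by every set that misses [A]. *)
have [B BA cB] : exists2 B : {set 'I_n}, B \subset A & #|B| = d.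
  exists [set x in take d (enum A)].
    by apply/subsetP => x; rewrite inE => /mem_take; rewrite mem_enum.
  rewrite cardsE; have /card_uniqP -> : uniq (take d (enum A)) by rewrite take_uniq ?enum_uniq.
  by rewrite size_takel // -cardE.
apply/bigcupP; exists (B, [set x in D | [disjoint [set f (x, j) | j : 'I_s] & A]]).
  rewrite inE /= cB eqxx /=; apply/andP; split.
    by apply/subsetP => x; rewrite inE => /andP[].
  move: tR; congr (_ < t * _); apply: eq_card => x; rewrite !inE ffunE //.
rewrite inE; apply/forallP => -[x j]; apply/implyP; rewrite /= inE => /andP[_ dis].
apply/negP => /(subsetP BA) fA.
have fS : f (x, j) \in [set f (x, j) | j : 'I_s] by apply: imset_f.
by have := disjointFr dis fS; rewrite fA.
Qed.

(** * Blocks, sparsifiers and spanning forests *)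

Lemma card_set_ord (m : nat) (A : {set 'I_m}) : #|A| <= m.
Proof. by rewrite -[X in _ <= X](card_ord m) max_card. Qed.

Lemma card_ord_lt (m k : nat) : #|[set w : 'I_m | w < k]| = minn k m.
Proof.
have -> : #|[set w : 'I_m | w < k]| = \sum_(w < m | w < k) 1.
  by rewrite -sum1_card; apply: eq_bigl => w; rewrite inE.
have [le_km|lt_mk] := leqP k m.
  by rewrite -(big_ord_widen m (fun=> 1) le_km) sum1_card card_ord.
rewrite (eq_bigl xpredT) ?sum1_card ?card_ord // => w.
exact: ltn_trans (ltn_ord w) lt_mk.
Qed.

(** The batches of the algorithm: [enum V] is cut into runs of [g] consecutive elements, and the
    first element of a run collects the data of the run. *)
Definition block_leader (T : finType) (g : nat) (V : {set T}) (v : T) : T :=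
  nth v (enum V) (index v (enum V) %/ g * g).

Section Blocks.
Variables (T : finType) (g : nat) (V : {set T}).
Implicit Types v b : T.

Lemma block_start_lt v : v \in V -> index v (enum V) %/ g * g < #|V|.
Proof.
move=> vV; apply: leq_ltn_trans (leq_trunc_div _ _) _.
by rewrite cardE index_mem mem_enum.
Qed.

Lemma block_leader_in v : v \in V -> block_leader g V v \in V.
Proof. by move=> vV; rewrite -mem_enum mem_nth // -cardE block_start_lt. Qed.

Lemma index_block_leader v : v \in V ->
  index (block_leader g V v) (enum V) = index v (enum V) %/ g * g.
Proof. by move=> vV; rewrite index_uniq ?enum_uniq // -cardE block_start_lt. Qed.

Lemma index_enum_inj : {in V &, injective (fun v => index v (enum V))}.
Proof.
move=> v w vV wV /= eq_vw.
by rewrite -(nth_index v (_ : v \in enum V)) ?mem_enum // eq_vw nth_index ?mem_enum.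
Qed.

(** Equal leaders mean equal quotients by [g], so the position modulo [g] separates the members of a
    block. *)
Lemma card_block b : 0 < g -> #|[set v in V | block_leader g V v == b]| <= g.
Proof.
case: g (fun v => index_block_leader (v := v)) => // h idx _.
pose f v : 'I_h.+1 := inord (index v (enum V) %% h.+1).
rewrite -[X in _ <= X]card_ord -(card_in_imset (f := f)) ?max_card //.
move=> v w; rewrite !inE => /andP[vV /eqP vb] /andP[wV /eqP wb].
move/(congr1 val); rewrite /= !inordK ?ltn_pmod // => eq_mod.
apply: index_enum_inj => //.
have := idx v vV; have := idx w wV; rewrite vb wb => iw iv.
by rewrite (divn_eq (index v _) h.+1) (divn_eq (index w _) h.+1) eq_mod -iv -iw.
Qed.

Lemma card_block_leaders : 0 < g -> #|block_leader g V @: V| <= #|V| %/ g + 1.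
Proof.
move=> g_gt0; rewrite addn1.
pose f b : 'I_(#|V| %/ g).+1 := inord (index b (enum V) %/ g).
rewrite -[X in _ <= X]card_ord -(card_in_imset (f := f)) ?max_card //.
have fK v : v \in V -> f (block_leader g V v) * g = index (block_leader g V v) (enum V).
  move=> vV; rewrite inordK; last first.
    rewrite ltnS leq_div2r //; rewrite cardE ltnW // index_mem mem_enum.
    exact: block_leader_in.
  by rewrite index_block_leader // mulnK.
move=> _ _ /imsetP[v vV ->] /imsetP[w wV ->] eq_f.
apply: index_enum_inj; rewrite ?block_leader_in //.
by rewrite -!fK // eq_f.
Qed.

End Blocks.

(** Geometric decay: at scale [2 ^ i] the first term costs [M], and the rest, at most [2 * M] at
    scale [2 ^ i.+1], costs another [M]. *)
Lemma sum_pow2_tail (u : nat -> nat) (M i k : nat) :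
  (forall j, i <= j < k -> 2 ^ j * u j <= M) ->
  2 ^ i * \sum_(i <= j < k) u j <= 2 * M.
Proof.
have [le_ki|lt_ik] := leqP k i; first by rewrite big_geq ?muln0.
elim: (k - i) {-2}i (erefl (k - i)) lt_ik => [|m IHm] {}i; first lia.
move=> im lt_ik bnd; rewrite big_ltn // mulnDr mul2n -addnn leq_add ?bnd ?leqnn //.
have [le_ki|lt_Sik] := leqP k i.+1; first by rewrite big_geq ?muln0.
have := IHm i.+1 ltac:(lia) lt_Sik; rewrite expnS => H.
have {}H : 2 * 2 ^ i * (\sum_(i.+1 <= j < k) u j) <= 2 * M.
  by apply: H => j /andP[? ?]; apply: bnd; lia.
by rewrite -(leq_pmul2l (_ : 0 < 2)) // mulnA.
Qed.

Lemma sum_pow4 (k : nat) : \sum_(i < k) 4 ^ i <= 4 ^ k.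
Proof.
elim: k => [|k IHk]; first by rewrite big_ord0.
rewrite big_ord_recr expnS /=; apply: leq_trans (leq_add IHk (leqnn _)) _; lia.
Qed.

(** * Sparse certificates of connectivity for edges between labels *)

Section Sparsifier.
Variables (Q T : finType) (l1 l2 : Q -> T).
Implicit Types (X Y : {set Q}) (x y : T).

Definition joins (q : Q) (x y : T) : bool :=
  (l1 q == x) && (l2 q == y) || (l1 q == y) && (l2 q == x).

Definition label_rel X : rel T := [rel x y | [exists q in X, joins q x y]].

Definition labels X : {set T} := l1 @: X :|: l2 @: X.

(** Stands in for a spanning forest of the multigraph whose vertices are the labels and whose edges
    are the elements of [X]: size and connectivity are recorded. *)
Definition sparsifies X Y : bool :=
  [&& Y \subset X, #|Y| <= #|labels X|
    & [forall q in X, connect (label_rel Y) (l1 q) (l2 q)]].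

Lemma label_rel_sym X : symmetric (label_rel X).
Proof. by move=> x y; apply: eq_existsb => q; rewrite /joins orbC. Qed.

Lemma label_relP X x y : reflect (exists2 q, q \in X & joins q x y) (label_rel X x y).
Proof. exact: exists_inP. Qed.

(** A breadth-first forest: every label other than the root of its component selects one edge to a
    label strictly closer to the root. This gives at most one edge per label, and following the
    selected edges leads to the root. *)
Lemma exists_sparsifier X : exists Y, sparsifies X Y.
Proof.
set e := label_rel X.
have ec_sym : connect_sym e by apply: sym_connect_sym; apply: label_rel_sym.
pose reach x k := [exists p : k.-tuple T, path e x p && (last x p == root e x)].
have ex_reach x : exists k, reach x k.
  have /connectP[p ep rE] := connect_root e x.
  by exists (size p); apply/existsP; exists (in_tuple p); rewrite ep -rE eqxx.
pose dist x := ex_minn (ex_reach x).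
have step x : root e x != x -> exists2 y, e x y & dist y < dist x.
  rewrite {2}/dist; case: ex_minnP => -[|k] /existsP[p /andP[ep /eqP lp]] _ nr.
    by rewrite (tuple0 p) /= in lp; rewrite -lp eqxx in nr.
  case: p ep lp => -[//|y p] /= sz /andP[exy ep] lp; exists y => //.
  rewrite /dist; case: ex_minnP => j _; apply; apply/existsP.
  exists (Tuple (sz : size p == k)); rewrite /= ep lp /=.
  by apply/eqP; apply/rootP => //; apply: connect1.
pose sel x := [pick q in X | [exists y, joins q x y && (dist y < dist x)]].
pose Y := [set q in X | [exists x in labels X, sel x == Some q]].
have YX : Y \subset X by apply/subsetP => q; rewrite inE => /andP[].
have to_root k x : dist x <= k -> connect (label_rel Y) x (root e x).
  elim: k x => [|k IHk] x dx; have [->|nr] := eqVneq (root e x) x;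
    rewrite ?connect0 //; have [y exy dy] := step x nr; first lia.
  have [q qX qxy] := label_relP _ _ _ exy.
  have xX : x \in labels X.
    by rewrite inE; case/orP: qxy => /andP[/eqP q1 /eqP q2];
      rewrite -?q1 -?q2 imset_f ?orbT.
  move: (erefl (sel x)); rewrite {2}/sel; case: pickP => [q'|/(_ q)]; last first.
    by rewrite qX /= => /negbT/negP[]; apply/existsP; exists y; rewrite qxy.
  case/andP=> q'X /existsP[z /andP[q'xz dz]] selx.
  have xz : label_rel Y x z.
    apply/label_relP; exists q' => //; rewrite inE q'X; apply/exists_inP.
    by exists x => //; apply/eqP.
  have -> : root e x = root e z.
    by apply/rootP => //; apply: connect1; apply/label_relP; exists q'.
  apply: connect_trans (connect1 xz) (IHk z _); lia.
exists Y; apply/and3P; split=> //.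
  rewrite -(card_imset _ (@Some_inj _)).
  apply: leq_trans (leq_imset_card sel (labels X)); apply: subset_leq_card.
  apply/subsetP => _ /imsetP[q + ->]; rewrite inE => /andP[_ /exists_inP[x xX /eqP<-]].
  exact: imset_f.
apply/forall_inP => q qX.
have Yc_sym : connect_sym (label_rel Y) by apply: sym_connect_sym; apply: label_rel_sym.
have r12 : root e (l1 q) = root e (l2 q).
  by apply/rootP => //; apply: connect1; apply/label_relP; exists q; rewrite // /joins !eqxx.
apply: connect_trans (to_root _ _ (leqnn _)) _.
by rewrite Yc_sym r12; apply: to_root (leqnn _).
Qed.

Definition sparsify X : {set Q} := odflt X [pick Y | sparsifies X Y].

Lemma sparsifyP X : sparsifies X (sparsify X).
Proof.
rewrite /sparsify; case: pickP => //= no.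
by have [Y] := exists_sparsifier X; rewrite no.
Qed.

Lemma sparsify_sub X : sparsify X \subset X.
Proof. by case/and3P: (sparsifyP X). Qed.

Lemma card_sparsify X : #|sparsify X| <= #|labels X|.
Proof. by case/and3P: (sparsifyP X). Qed.

Lemma connect_sparsify X q :
  q \in X -> connect (label_rel (sparsify X)) (l1 q) (l2 q).
Proof. by case/and3P: (sparsifyP X) => _ _ /forall_inP; apply. Qed.

End Sparsifier.

(** * Spanning forests of minimal size and degree sums *)

Section SpanningForest.
Variable n : nat.
Implicit Types (E F : {set {set 'I_n}}) (G : sgraph n).

Lemma edge_rel_sym E : symmetric (edge_rel E).
Proof. by move=> x y; rewrite /edge_rel /= eq_sym setUC. Qed.

Lemma mem_edges G x y : G x y -> [set x; y] \in edges G.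
Proof. by move=> Gxy; apply/imsetP; exists (x, y); rewrite ?inE. Qed.

Lemma adj_neq G x y : G x y -> x != y.
Proof. by apply: contraTneq => ->; rewrite adj_irr. Qed.

Lemma edges_adj G x y : x != y -> [set x; y] \in edges G -> G x y.
Proof.
move=> nxy /imsetP[[a b]]; rewrite inE /= => Gab eqE.
have /set2P[] : x \in [set a; b] by rewrite -eqE set21.
all: have /set2P[] : y \in [set a; b] by rewrite -eqE set22.
all: move=> yE xE; move: nxy Gab; rewrite yE xE ?eqxx // => _.
by rewrite adj_sym.
Qed.

Definition preserves E F : bool :=
  (F \subset E) &&
  [forall x, forall y, edge_rel E x y ==> connect (edge_rel F) x y].

Lemma preserves_refl E : preserves E E.
Proof.
apply/andP; split=> //; apply/forallP => x; apply/forallP => y; apply/implyP.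
exact: connect1.
Qed.

Definition min_forest E := [arg min_(F < E | preserves E F) #|F|].

Lemma min_forest_sub E : min_forest E \subset E.
Proof. by rewrite /min_forest; case: arg_minnP => [|F /andP[]]; rewrite ?preserves_refl. Qed.

Lemma connect_min_forest E x y :
  connect (edge_rel E) x y -> connect (edge_rel (min_forest E)) x y.
Proof.
apply: connect_sub => {x y} x y exy.
rewrite /min_forest; case: arg_minnP => [|F]; rewrite ?preserves_refl //.
by case/andP=> _ /forallP/(_ x)/forallP/(_ y)/implyP/(_ exy).
Qed.

(* An edge of a cycle is redundant, so that a set of edges of minimal size
   preserving connectivity has no cycle. *)
Lemma min_forest_acyclic E : acyclic (min_forest E).
Proof.
rewrite /min_forest; case: arg_minnP => [|F]; first exact: preserves_refl.
case/andP=> FE /forallP pF minF c uc cc; rewrite leqNgt; apply/negP.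
case: c uc cc => [//|x [//|y [//|z c]]] uc cc _.
move: uc; rewrite /= !inE !negb_or => /and4P[/and3P[xy xz xc] /andP[yz yc] zc uc].
have [exy [eyz ezc]] : edge_rel F x y /\ edge_rel F y z /\ path (edge_rel F) z (rcons c x).
  by case/and3P: cc.
set A := [set x; y]; have AF : A \in F by case/andP: exy.
have keep a b : a \notin A -> edge_rel F a b -> edge_rel (F :\ A) a b.
  move=> aA /andP[ab abF]; rewrite /edge_rel /= ab !inE abF andbT /=.
  by apply: contraNneq aA => <-; rewrite set21.
have keep_path s a : a \notin A -> all [predC A] s ->
    path (edge_rel F) a (rcons s x) -> path (edge_rel (F :\ A)) a (rcons s x).
  elim: s a => [|b s IHs] a aA /=; first by rewrite !andbT => _; apply: keep.
  case/andP=> bA sA /andP[ab bs]; apply/andP; split; first exact: keep.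
  exact: IHs.
have zA : z \notin A by rewrite !inE negb_or ![z == _]eq_sym xz.
have cA : all [predC A] c.
  apply/allP => a ac; rewrite !inE negb_or.
  by apply/andP; split; apply: contraTneq ac => ->.
(* The rest of the cycle is a detour around [A]: each of its edges has an end outside [A] and
   survives the removal of [A]. *)
have yx : connect (edge_rel (F :\ A)) y x.
  apply/connectP; exists (z :: rcons c x); last by rewrite /= last_rcons.
  rewrite /= (keep_path c z) // andbT.
  by rewrite edge_rel_sym keep // edge_rel_sym.
have sym' : connect_sym (edge_rel (F :\ A)) by apply: sym_connect_sym; apply: edge_rel_sym.
have sub a b : edge_rel F a b -> connect (edge_rel (F :\ A)) a b.
  move=> eab; have [aA|aA] := boolP (a \in A); last by apply: connect1; apply: keep.
  have [bA|bA] := boolP (b \in A); last first.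
    by rewrite sym'; apply: connect1; apply: keep; rewrite // edge_rel_sym.
  case/set2P: aA => ->; case/set2P: bA => ->; rewrite ?connect0 //.
  by rewrite (sym' x y).
suff /minF : preserves E (F :\ A).
  by rewrite leqNgt [X in _ < X](cardsD1 A) AF ltnSn.
apply/andP; split; first by apply: subset_trans FE; apply: subD1set.
apply/forallP => a; apply/forallP => b; apply/implyP => eab.
have := pF a; move=> /forallP/(_ b)/implyP/(_ eab).
exact: connect_sub.
Qed.

(** The tree of a component consists of the forest edges inside it: a forest path starting in the
    component uses edges of [G], so it never leaves. *)
Lemma min_forest_spanning G E :
  E \subset edges G -> (forall x y, G x y -> connect (edge_rel E) x y) ->
  spanning_forest G (min_forest E).
Proof.
set F := min_forest E => EG GE.
have FG : F \subset edges G := subset_trans (min_forest_sub E) EG.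
split=> // [|x]; first exact: min_forest_acyclic.
have subrel_adj y z : edge_rel F y z -> G y z.
  by case/andP=> nyz /(subsetP FG); apply: edges_adj.
pose T := [set A in F | A \subset component G x].
have TF : T \subset F by apply/subsetP => A; rewrite inE => /andP[].
exists T => //; split=> [|A|c uc cc|y z].
- exact: subset_trans TF FG.
- by rewrite inE => /andP[].
- apply: (@min_forest_acyclic E) uc _; apply: sub_cycle cc => a b /andP[ab abT].
  by apply/andP; split; rewrite // (subsetP TF).
rewrite !inE => xy xz.
have G_sym : connect_sym G by apply: sym_connect_sym; apply: adj_sym.
have : connect (edge_rel F) y z.
  apply: connect_min_forest; apply: (connect_sub GE).
  by apply: connect_trans xz; rewrite G_sym.
case/connectP=> p; elim: p y xy => [|w p IHp] y xy /=; first by move=> _ ->.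
case/andP=> yw wp lp; have xw := connect_trans xy (connect1 (subrel_adj _ _ yw)).
apply: connect_trans (IHp w xw wp lp); apply: connect1.
case/andP: yw => nyw ywF; rewrite /edge_rel /= nyw inE ywF.
by apply/subsetP => a /set2P[] ->; rewrite inE.
Qed.

Definition nbrs G v : {set 'I_n} := [set w | G v w].

(** The handshake bound: at most two ordered pairs share a set of endpoints. The messages of every
    phase are charged, directly or not, to this sum. *)
Lemma sum_degrees G : \sum_v #|nbrs G v| <= 2 * #|edges G|.
Proof.
pose D := [set p : 'I_n * 'I_n | G p.1 p.2].
have -> : \sum_v #|nbrs G v| = #|D|.
  rewrite -sum1_card (eq_bigl (fun p => G p.1 p.2)) => [|p]; last by rewrite inE.
  rewrite -(pair_big_dep xpredT (fun v w => G v w) (fun _ _ => 1)) /=.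
  by apply: eq_bigr => v _; rewrite sum1_card; apply: eq_card => w; rewrite inE.
rewrite -sum1_card (partition_big (fun p => [set p.1; p.2]) (mem (edges G))) /=; last first.
  by move=> p; rewrite inE; apply: mem_edges.
rewrite mulnC -sum_nat_const; apply: leq_sum => A /imsetP[[a b] _ /= ->].
rewrite sum1_card; apply: leq_trans (_ : #|[set (a, b); (b, a)]| <= 2); last first.
  by rewrite cards2; case: eqP.
apply: subset_leq_card; apply/subsetP => -[c d]; rewrite unfold_in /= inE /= => /andP[Gcd /eqP eqs].
have /set2P[] : c \in [set a; b] by rewrite -eqs set21.
all: have /set2P[] : d \in [set a; b] by rewrite -eqs set22.
all: by move=> dE cE; move: Gcd; rewrite dE cE ?adj_irr // !inE eqxx ?orbT.
Qed.

End SpanningForest.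

(** * Composition of routed phases *)

Section Encoding.
Variables (M : finType) (b : nat).

Definition encode (m : M) : message :=
  nth [::] [seq tval t | t <- enum {: b.-tuple bool}] (enum_rank m).

Definition decode (s : message) : option M := [pick m | encode m == s].

Hypothesis le_Mb : #|M| <= 2 ^ b.

Lemma encode_bound (m : M) :
  enum_rank m < size [seq tval t | t <- enum {: b.-tuple bool}].
Proof.
rewrite size_map -cardE card_tuple card_bool.
exact: leq_trans (ltn_ord _) le_Mb.
Qed.

Lemma size_encode m : size (encode m) = b.
Proof. by have /mapP[t _ E] := mem_nth [::] (encode_bound m); rewrite /encode E size_tuple. Qed.

Lemma encode_inj : injective encode.
Proof.
move=> m m' /eqP; rewrite nth_uniq ?encode_bound //.
  by move/eqP/val_inj/enum_rank_inj.
by rewrite map_inj_uniq ?enum_uniq //; apply: val_inj.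
Qed.

Lemma pmap_decode s : pmap decode (map encode s) = s.
Proof.
elim: s => //= m s ->; rewrite /decode; case: pickP => [m' /eqP/encode_inj -> //|/(_ m)].
by rewrite eqxx.
Qed.

End Encoding.

Section Framework.
Variables (n B C : nat).
Implicit Types (G : sgraph n) (u v w : 'I_n).

(** After [K] invocations of the routing protocol, every player [v] knows
    [x G v], and at most [a] messages per edge have been sent. *)
Definition realizes (K : nat) (T : Type) (x : sgraph n -> 'I_n -> T) (a : nat) :=
  {P : algorithm n & {dec : 'I_n -> state P -> T |
    [/\ schedule P = nseq K Route,
        forall G v, dec v (config P G K v) = x G v,
        forall G k, k < K -> admissible P G B C k
      & forall G, communication P G <= a * #|edges G|]}}.

Lemma realizes_init : realizes 0 (@nbrs n) 0.
Proof.
exists (@Algorithm n _ (fun _ A => A) [::] (fun _ _ _ _ => [::])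
  (fun _ _ s _ => s) (fun _ _ => None)).
exists (fun _ A => A); split=> // G.
by rewrite /communication big_ord0.
Qed.

(** Local computation is free: it is absorbed into the decoder and the algorithm stays the same. *)
Lemma realizes_map K T T' (x : sgraph n -> 'I_n -> T) (y : sgraph n -> 'I_n -> T') a
    (f : 'I_n -> T -> T') :
  (forall G v, f v (x G v) = y G v) -> realizes K x a -> realizes K y a.
Proof.
move=> fxy [P [dec [sP decP adm com]]].
by exists P, (fun v s => f v (dec v s)); split=> // G v; rewrite decP.
Qed.

Section Step.
Variables (K : nat) (T : Type) (P : algorithm n) (dec : 'I_n -> state P -> T).
Variables (M : finType) (snd : 'I_n -> T -> 'I_n -> seq M).
Let b := B * trunc_log 2 n.

(* A player cannot address itself: it computes the messages from itself. *)
Definition step_algorithm : algorithm n :=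
  @Algorithm n (state P + state P * ('I_n -> seq M))
    (fun v A => inl (init P v A))
    (nseq K.+1 Route)
    (fun k u st w =>
       if st is inl s then
         if k < K then send k u s w
         else if u == w then [::] else map (encode b) (snd u (dec u s) w)
       else [::])
    (fun k v st inbox =>
       if st is inl s then
         if k < K then inl (receive k v s inbox)
         else inr (s, fun u => if u == v then snd v (dec v s) v
                               else pmap (@decode M b) (inbox u))
       else st)
    (fun _ _ => None).

(** Up to phase [K] the extended algorithm simulates [P] under [inl]; [inr] appears only after the
    additional phase and pairs the last state of [P] with the decoded inbox. *)
Lemma step_config G k : k <= K ->
  forall v, config step_algorithm G k v = inl (config P G k v).
Proof.
elim: k => [|k IHk] lt_kK v //=; rewrite IHk ?(ltnW lt_kK) //= lt_kK.
congr (inl (receive _ _ _ _)); apply: functional_extensionality => u.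
by rewrite IHk ?(ltnW lt_kK) //= lt_kK.
Qed.

Lemma step_sent_old G k : k < K -> forall u v, sent step_algorithm G k u v = sent P G k u v.
Proof. by move=> lt_kK u v; rewrite /sent step_config ?(ltnW lt_kK) //= lt_kK. Qed.

Lemma step_sent_new G u v : sent step_algorithm G K u v =
  if u == v then [::] else map (encode b) (snd u (dec u (config P G K u)) v).
Proof. by rewrite /sent step_config //= ltnn. Qed.

End Step.

(** Only distinct players exchange messages, whence the guard [1 < n]: for [n = 1] the bit budget is
    0, but nothing is sent. The three sums also count what a player addresses to itself, an
    overestimate. *)
Lemma realizes_step K T (x : sgraph n -> 'I_n -> T) a a' (M : finType)
    (snd : 'I_n -> T -> 'I_n -> seq M) :
  (1 < n -> #|M| <= 2 ^ (B * trunc_log 2 n)) ->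
  (forall G u, \sum_w size (snd u (x G u) w) <= C * n) ->
  (forall G w, \sum_u size (snd u (x G u) w) <= C * n) ->
  (forall G, \sum_u \sum_w size (snd u (x G u) w) <= a' * #|edges G|) ->
  realizes K x a ->
  realizes K.+1 (fun G v => (x G v, fun u => snd u (x G u) v)) (a + a').
Proof.
move=> leM le_out le_in le_tot [P [dec [sP decP adm com]]].
have ne_n u v : u != v -> 1 < n.
  by case: n u v => [[]//|[|//]] u v; rewrite !ord1.
exists (step_algorithm K dec snd).
exists (fun v st => match st with
  | inl s => (dec v s, fun=> [::]) | inr (s, inbox) => (dec v s, inbox) end).
have new_size G u v : size (sent (step_algorithm K dec snd) G K u v) <= size (snd u (x G u) v).
  by rewrite step_sent_new decP; case: eqP => //; rewrite size_map.
split=> // [G v|G k|G].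
- rewrite /= step_config //= ltnn decP; congr (_, _).
  apply: functional_extensionality => u.
  rewrite step_config //= !decP; case: eqVneq => [-> //|ne_uv].
  by rewrite pmap_decode // leM // (ne_n _ _ ne_uv).
- rewrite ltnS leq_eqVlt => /orP[/eqP->|lt_kK].
    split=> [v|u v msg|u|v|].
    + by rewrite step_sent_new eqxx.
    + rewrite step_sent_new; case: eqVneq => // ne_uv /mapP[m _ ->].
      by rewrite size_encode // leM // (ne_n _ _ ne_uv).
    + by apply: leq_trans (le_out G u); apply: leq_sum.
    + by apply: leq_trans (le_in G v); apply: leq_sum.
    by rewrite nth_nseq if_same.
  case: (adm G k lt_kK) => a1 a2 a3 a4 _; split=> [v|u v msg|u|v|].
  + by rewrite step_sent_old.
  + by rewrite step_sent_old //; apply: a2.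
  + by under eq_bigr do rewrite step_sent_old //.
  + by under eq_bigr do rewrite step_sent_old //.
  by rewrite nth_nseq if_same.
rewrite /communication [size _]size_nseq big_ord_recr mulnDl leq_add //.
  apply: leq_trans (com G); rewrite /communication sP size_nseq.
  by apply: leq_sum => k _; apply: leq_sum => u _; apply: leq_sum => v _; rewrite step_sent_old /=.
by apply: leq_trans (le_tot G); apply: leq_sum => u _; apply: leq_sum.
Qed.

(** With at most one message per ordered pair, every player sends and receives at most [n] messages,
    so only message length and total remain to be checked. *)
Lemma realizes_talk K T (x : sgraph n -> 'I_n -> T) a a' (M : finType)
    (f : 'I_n -> T -> 'I_n -> option M) :
  (1 < n -> #|M| <= 2 ^ (B * trunc_log 2 n)) -> 0 < C ->
  (forall G, \sum_u #|[set w | f u (x G u) w]| <= a' * #|edges G|) ->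
  realizes K x a ->
  realizes K.+1 (fun G v => (x G v, [ffun u => f u (x G u) v])) (a + a').
Proof.
move=> leM C_gt0 le_tot rx; pose single := oapp (fun m : M => [:: m]) [::].
have size_single o : size (single o) = isSome o by case: o.
have le_n (g : 'I_n -> option M) : \sum_u size (single (g u)) <= C * n.
  apply: (@leq_trans (\sum_(u < n) C)); last by rewrite sum_nat_const card_ord mulnC.
  by apply: leq_sum => u _; rewrite size_single; case: isSome.
have := @realizes_step K T x a a' M (fun u s w => single (f u s w)) leM.
move=> /(_ (fun G u => le_n _) (fun G w => le_n _) _ rx) H.
apply: (realizes_map (f := fun v p => (p.1, [ffun u => ohead (p.2 u)]))) (H _) => [G v|G] /=.
  by congr (_, _); apply/ffunP => u; rewrite !ffunE; case: (f _ _ _).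
apply: leq_trans (le_tot G); apply: leq_sum => u _; rewrite -sum1_card.
rewrite [X in _ <= X]big_mkcond /=; apply: leq_sum => w _.
by rewrite inE size_single; case: isSome.
Qed.

(** Each player sends its whole set to one destination, so the bound on incoming messages also
    bounds the outgoing ones. *)
Lemma realizes_gather K T (x : sgraph n -> 'I_n -> T) a a' (M : finType)
    (dst : 'I_n -> T -> option 'I_n) (Z : 'I_n -> T -> {set M}) :
  (1 < n -> #|M| <= 2 ^ (B * trunc_log 2 n)) ->
  (forall G w, \sum_(u | dst u (x G u) == Some w) #|Z u (x G u)| <= C * n) ->
  (forall G, \sum_u #|Z u (x G u)| <= a' * #|edges G|) ->
  realizes K x a ->
  realizes K.+1
    (fun G v => (x G v, \bigcup_(u | dst u (x G u) == Some v) Z u (x G u)))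
    (a + a').
Proof.
move=> leM le_in le_tot rx.
pose snd u s w := if dst u s == Some w then enum (Z u s) else [::].
have size_snd u s w : size (snd u s w) = if dst u s == Some w then #|Z u s| else 0.
  by rewrite /snd; case: ifP; rewrite // -cardE.
have out_le u s : \sum_w size (snd u s w) <= #|Z u s|.
  under eq_bigr do rewrite size_snd.
  rewrite -big_mkcond /=; case: (dst u s) => [w0|]; last by rewrite big_pred0_eq.
  by rewrite (big_pred1 w0) // => w; apply/eqP/eqP => [[->]|->].
apply: (realizes_map (f := fun v p => (p.1, [set m | [exists u, m \in p.2 u]])))
  (@realizes_step K T x a a' M snd leM _ _ _ rx) => [G v|G u|G w|G] /=.
- congr (_, _); apply/setP => m; rewrite inE; apply/existsP/bigcupP => [[u]|[u E mZ]].
    by rewrite /snd; case: ifP => // E; rewrite mem_enum => mZ; exists u.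
  by exists u; rewrite /snd E mem_enum.
- have [w E|none] := pickP (fun w => dst u (x G u) == Some w).
    apply: leq_trans (out_le u _) (leq_trans _ (le_in G w)).
    by rewrite (bigD1 u) //= leq_addr.
  by rewrite big1 // => w _; rewrite size_snd none.
- under eq_bigr do rewrite size_snd.
  by rewrite -big_mkcond.
by apply: leq_trans (le_tot G); apply: leq_sum => u _; apply: out_le.
Qed.

End Framework.

Lemma sum_card_bigcup (T : finType) (n : nat) (dst : 'I_n -> option 'I_n)
    (Z : 'I_n -> {set T}) :
  \sum_w #|\bigcup_(u | dst u == Some w) Z u| <= \sum_u #|Z u|.
Proof.
apply: (@leq_trans (\sum_w \sum_(u | dst u == Some w) #|Z u|)).
  apply: leq_sum => w _; elim/big_rec2: _ => [|u m U _ IH]; first by rewrite cards0.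
  by rewrite (leq_trans (leq_card_setU _ _)) // leq_add2l.
under eq_bigr do rewrite big_mkcond.
rewrite exchange_big /=; apply: leq_sum => u _; rewrite -big_mkcond /=.
case: (dst u) => [w0|]; last by rewrite big_pred0_eq.
by rewrite (big_pred1 w0) // => w; apply/eqP/eqP => [[->]|->].
Qed.

(** * The algorithm *)

Section Algorithm.
Variables (n0 lg : nat).
Local Notation n := n0.+1.
Local Notation L := lg.+1.
Hypothesis lgE : lg = trunc_log 2 n.
Implicit Types (G : sgraph n) (A : {set 'I_n}) (i : 'I_L) (p : 'I_n * 'I_L).

(** * Degree classes and the choice of a seed per class *)

Definition degree_class A : 'I_L := inord (trunc_log 4 #|A|).

(** A degree is at most [n], so its base-4 logarithm is at most [lg] and [inord] does not alter
    it. *)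
Lemma degree_classP A : A != set0 ->
  4 ^ degree_class A <= #|A| < 4 ^ (degree_class A).+1.
Proof.
rewrite -card_gt0 => A_gt0; rewrite inordK; first exact: trunc_log_bounds.
have /andP[le4 _] := trunc_log_bounds (isT : 1 < 4) A_gt0.
rewrite ltnS lgE trunc_log_max //.
apply: leq_trans (card_set_ord A); apply: leq_trans le4.
by rewrite -[4]/(2 ^ 2) -expnM leq_exp2l // mul2n -addnn leq_addr.
Qed.

(** The seed [(e, l)] names the [l]-th set tested by player [e]: for class [i], the first [4 ^ i]
    players test [L] sets each. *)
Definition seeds i : {set 'I_n * 'I_L} := [set p : 'I_n * 'I_L | p.1 < 4 ^ i].

Definition disperses i (S : {ffun 'I_n * 'I_L -> {set 'I_n}}) : bool :=
  [forall p, #|S p| <= (n %/ 4 ^ i).+1 * 2 ^ i] &&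
  [forall A : {set 'I_n}, (4 ^ i <= #|A|) ==>
     (2 ^ i * #|[set p in seeds i | [disjoint S p & A]]| <= 2 * #|seeds i|)].

(** The choice by [pick] is deterministic, so all players find the same family without
    communicating. *)
Definition disp i : {ffun 'I_n * 'I_L -> {set 'I_n}} :=
  odflt [ffun=> set0] [pick S | disperses i S].

Lemma card_seeds i : 4 ^ i <= n -> #|seeds i| = 4 ^ i * L.
Proof.
move=> le4; have -> : seeds i = setX [set e : 'I_n | e < 4 ^ i] [set: 'I_L].
  by apply/setP => p; rewrite !inE andbT.
by rewrite cardsX cardsT card_ord card_ord_lt (minn_idPl le4).
Qed.

(** The disperser lemma applies with [d = 4 ^ i] and [t = 2 ^ i], because [n < 2 ^ L] and there are
    [4 ^ i * L] seeds. *)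
Lemma dispP i : 4 ^ i <= n -> disperses i (disp i).
Proof.
move=> le4; rewrite /disp; case: pickP => //= no.
have [||S SP] := @exists_disperser n (4 ^ i) (2 ^ i) _ (seeds i).
- by rewrite expn_gt0.
- rewrite card_seeds // mulnC expnM leq_exp2r ?expn_gt0 // lgE.
  by have /andP[_ /ltnW] := trunc_log_bounds (isT : 1 < 2) (isT : 0 < n).
by have := no S; rewrite /disperses SP.
Qed.

Definition vclass G i : {set 'I_n} :=
  [set v | (nbrs G v != set0) && (degree_class (nbrs G v) == i)].

Definition active G : {set 'I_n} := [set v | nbrs G v != set0].

Definition missed G i p : {set 'I_n} :=
  [set v in vclass G i | [disjoint disp i p & nbrs G v]].

Definition good G i p : bool := 2 ^ i * #|missed G i p| <= 2 * #|vclass G i|.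

Lemma vclass_class G i v : v \in vclass G i -> degree_class (nbrs G v) = i.
Proof. by rewrite inE => /andP[_ /eqP]. Qed.

Lemma vclass_degree G i v : v \in vclass G i -> 4 ^ i <= #|nbrs G v| < 4 ^ i.+1.
Proof. by rewrite inE => /andP[/degree_classP + /eqP <-]. Qed.

Lemma vclass_le G i v : v \in vclass G i -> 4 ^ i <= n.
Proof.
case/vclass_degree/andP=> le4 _; exact: leq_trans le4 (card_set_ord _).
Qed.

Lemma adj_active G v u : G v u -> v \in active G.
Proof. by move=> Gvu; rewrite inE; apply/set0Pn; exists u; rewrite inE. Qed.

Lemma active_vclass G v : v \in active G -> v \in vclass G (degree_class (nbrs G v)).
Proof. by rewrite !inE eqxx andbT. Qed.

(** Double counting of the pairs of a seed and a class vertex whose neighbourhood it misses: each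
    vertex is missed by at most a fraction [2 / 2 ^ i] of the seeds, so some seed misses at most
    that fraction of the class. *)
Lemma exists_good G i : vclass G i != set0 -> exists2 p, p \in seeds i & good G i p.
Proof.
case/set0Pn=> v0 v0i; have le4 := vclass_le v0i; apply/exists_inP.
apply: contraT; rewrite negb_exists_in => /forall_inP bad.
have /andP[_ /forallP dis] := dispP le4.
have seeds_gt0 : 0 < #|seeds i| by rewrite card_seeds // muln_gt0 expn_gt0.
have: \sum_(p in seeds i) (2 * #|vclass G i|).+1 <= \sum_(p in seeds i) 2 ^ i * #|missed G i p|.
  by apply: leq_sum => p /bad; rewrite -ltnNge.
rewrite sum_nat_const -big_distrr /= leqNgt => /negP[].
apply: (@leq_ltn_trans (#|vclass G i| * (2 * #|seeds i|))); last first.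
  rewrite mulnS mulnCA [_ * #|seeds i|]mulnC [X in _ < _ + X]mulnCA.
  by rewrite -[X in X < _]add0n ltn_add2r.
have -> : \sum_(p in seeds i) #|missed G i p| =
    \sum_(v in vclass G i) #|[set p in seeds i | [disjoint disp i p & nbrs G v]]|.
  under eq_bigr do rewrite -sum1_card.
  under [RHS]eq_bigr do rewrite -sum1_card.
  rewrite (exchange_big_dep (mem (vclass G i))) /= => [|p v _]; last by rewrite inE => /andP[].
  apply: eq_bigr => v vi; apply: eq_bigl => p.
  by rewrite [v \in missed _ _ _]inE vi [RHS]inE.
rewrite big_distrr /= -sum_nat_const; apply: leq_sum => v /vclass_degree/andP[le_deg _].
by have /implyP := dis (nbrs G v); apply.
Qed.

(** A player [e < 4 ^ i] hears from every vertex of class [i], hence can decide [good] for its own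
    seeds. *)
Definition report G (e : 'I_n) i : option 'I_L :=
  if (vclass G i != set0) && (e < 4 ^ i) then [pick l | good G i (e, l)] else None.

Definition seed G i : option ('I_n * 'I_L) :=
  [pick p | report G p.1 i == Some p.2].

Lemma seedP G i : vclass G i != set0 -> exists2 p, seed G i = Some p & good G i p.
Proof.
move=> ne; rewrite /seed; case: pickP => [p|none].
  move=> H; exists p => //; move: H; rewrite /report; case: ifP => // _.
  by case: pickP => // l + /eqP[lE]; rewrite lE -surjective_pairing.
have [[e l] + gp] := exists_good ne; rewrite inE /= => le_e.
have: report G e i != None.
  by rewrite /report ne le_e; case: pickP => // /(_ l); rewrite gp.
by case E: (report G e i) => [l'|] // _; have := none (e, l'); rewrite /= E eqxx.
Qed.

(** Batch sizes that keep loads linear: a vertex of class [i] has fewer than [4 ^ i.+1] edges, and a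
    sparsified first batch keeps at most [8 * n / 2 ^ i]. *)
Definition leader1 i (V : {set 'I_n}) := block_leader (n %/ 4 ^ i).+1 V.
Definition leader2 i (V : {set 'I_n}) := block_leader (2 ^ i) (leader1 i V @: V).

Definition plan (V : {ffun 'I_L -> {set 'I_n}})
    (sd : {ffun 'I_L -> option ('I_n * 'I_L)}) (v : 'I_n) :
    option (('I_n * 'I_L) * ('I_n * 'I_n)) :=
  omap (fun i => (odflt (ord0, ord0) (sd i), (leader1 i (V i) v, leader2 i (V i) v)))
    [pick i | v \in V i].

Definition plan_of G := plan [ffun i => vclass G i] [ffun i => seed G i].

Lemma plan_ofE G i v : v \in vclass G i ->
  plan_of G v = Some (odflt (ord0, ord0) (seed G i),
    (leader1 i (vclass G i) v, leader2 i (vclass G i) v)).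
Proof.
move=> vi; rewrite /plan_of /plan; case: pickP => [j|/(_ i)]; rewrite ffunE ?vi //.
by move=> vj; rewrite /= !ffunE -(vclass_class vi) -(vclass_class vj).
Qed.

Lemma plan_of_active G v : isSome (plan_of G v) = (v \in active G).
Proof.
apply/idP/idP => [|/active_vclass/plan_ofE -> //].
by rewrite /plan_of /plan; case: pickP => // i; rewrite ffunE !inE => /andP[].
Qed.

(** * Pointers and supernodes *)

Definition local_pointer A (pl : option (('I_n * 'I_L) * ('I_n * 'I_n))) : option 'I_n :=
  if pl is Some (p, _) then [pick w in A :&: disp (degree_class A) p] else None.

Definition pointer G : {ffun 'I_n -> option 'I_n} :=
  [ffun v => local_pointer (nbrs G v) (plan_of G v)].

Definition pointer_rel (h : {ffun 'I_n -> option 'I_n}) : rel 'I_n :=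
  [rel x y | (h x == Some y) || (h y == Some x)].

Lemma pointer_rel_sym h : symmetric (pointer_rel h).
Proof. by move=> x y; rewrite /pointer_rel /= orbC. Qed.

(** Supernodes are the components of the pointer graph, named by their canonical representatives. *)
Definition label G v := root (pointer_rel (pointer G)) v.

Lemma pointer_adj G v w : pointer G v = Some w -> G v w.
Proof.
rewrite ffunE /local_pointer; case: plan_of => // -[p _].
by case: pickP => // u + [<-]; rewrite !inE => /andP[].
Qed.

Lemma pointer_label G v w : pointer G v = Some w -> label G v = label G w.
Proof.
move=> vw; apply/rootP; first by apply: sym_connect_sym; apply: pointer_rel_sym.
by apply: connect1; rewrite /pointer_rel /= vw eqxx.
Qed.

Definition high_labels G (i : nat) : {set 'I_n} :=
  [set label G v | v in [set v in active G | i <= degree_class (nbrs G v)]].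

(* Every vertex of class [j] points into the part of [disp j] selected by its
   seed or is one of the few missed ones, so the labels of class [j] number at
   most [4 n / 2 ^ j]. *)
Lemma card_high_labels G (i : nat) : 2 ^ i * #|high_labels G i| <= 8 * n.
Proof.
pose sd j := odflt (ord0, ord0) (seed G j).
pose U (j : 'I_L) := if vclass G j == set0 then set0
  else disp j (sd j) :|: missed G j (sd j).
have cU (j : 'I_L) : 2 ^ j * #|U j| <= 4 * n.
  rewrite /U; case: ifPn => [_|ne]; first by rewrite cards0 muln0.
  have [p sp gp] := seedP ne; rewrite /sd sp /=.
  have [v vj] := set0Pn _ ne; have le4 := vclass_le vj.
  have /andP[/forallP/(_ p) cS _] := dispP le4.
  have cV : #|vclass G j| <= n by apply: card_set_ord.
  apply: leq_trans (leq_mul (leqnn _) (leq_card_setU _ _)) _; rewrite mulnDr.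
  (* The left side is at most [n + 4 ^ j], and [4 ^ j <= n] since the class is inhabited. *)
  have : 2 ^ j * #|disp j p| <= 2 * n.
    apply: leq_trans (leq_mul (leqnn _) cS) _.
    rewrite mulnCA -expnMn -[2 * 2]/4 mulSn.
    by have := leq_trunc_div n (4 ^ j); lia.
  by move: gp; rewrite /good; lia.
have sub : high_labels G i \subset \bigcup_(j : 'I_L | i <= j) label G @: U j.
  apply/subsetP => _ /imsetP[v + ->]; rewrite inE => /andP[va iv].
  apply/bigcupP; exists (degree_class (nbrs G v)) => //.
  have vj := active_vclass va; set j := degree_class _ in iv vj *.
  have ne : vclass G j != set0 by apply/set0Pn; exists v.
  rewrite /U (negbTE ne).
  have pE : pointer G v = [pick w in nbrs G v :&: disp j (sd j)].
    by rewrite ffunE (plan_ofE vj) /=.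
  case: pickP pE => [w wS|none] pE; last first.
    apply: imset_f; rewrite !inE; apply/orP; right; move: vj; rewrite inE => ->.
    rewrite disjoint_sym -setI_eq0; apply/eqP/setP => w.
    by have := none w; rewrite in_set0.
  rewrite (pointer_label pE); apply: imset_f.
  by move: wS; rewrite !inE => /andP[_ ->].
have -> : 8 * n = 2 * (4 * n) by rewrite mulnA.
pose u j := #|U (inord j)|.
have := @sum_pow2_tail u (4 * n) i L.
rewrite big_geq_mkord => H.
apply: leq_trans (H _); last first.
  by move=> j /andP[_ ltj]; have := cU (inord j); rewrite /u inordK.
rewrite leq_mul2l; apply/orP; right.
apply: leq_trans (subset_leq_card sub) _.
elim/big_rec2: _ => [|j m W _ IH]; first by rewrite cards0.
rewrite (leq_trans (leq_card_setU _ _)) // leq_add // /u inord_val.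
exact: leq_imset_card.
Qed.

(** * Collecting the edges in three stages *)

(* An edge with the labels of its endpoints: ((v, u), (label v, label u)). *)
Definition Q : finType := (('I_n * 'I_n) * ('I_n * 'I_n))%type.
Definition lab1 (q : Q) := q.2.1.
Definition lab2 (q : Q) := q.2.2.

(** An edge is owned by its end of smaller class, and by both ends in a tie. Hence both labels of an
    edge owned in class [i] lie in [high_labels G i]. *)
Definition up_edges G v : {set Q} :=
  [set q : Q | [&& q.1.1 == v, G v q.1.2,
     degree_class (nbrs G v) <= degree_class (nbrs G q.1.2),
     q.2.1 == label G v & q.2.2 == label G q.1.2]].

Definition dst1 (pl : option (('I_n * 'I_L) * ('I_n * 'I_n))) := omap (fun m => m.2.1) pl.
Definition dst2 (pl : option (('I_n * 'I_L) * ('I_n * 'I_n))) := omap (fun m => m.2.2) pl.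

(** What reaches a first leader, a second leader and finally the coordinator. *)
Definition edges1 G b : {set Q} :=
  \bigcup_(v | dst1 (plan_of G v) == Some b) up_edges G v.
Definition edges2 G c : {set Q} :=
  \bigcup_(b | dst2 (plan_of G b) == Some c) sparsify lab1 lab2 (edges1 G b).
Definition edges3 G : {set Q} :=
  \bigcup_c sparsify lab1 lab2 (edges2 G c).

Definition known_edges (h : {ffun 'I_n -> option 'I_n}) (X : {set Q}) : {set {set 'I_n}} :=
  [set [set p.1; p.2] | p in [set p : 'I_n * 'I_n | h p.1 == Some p.2]] :|:
  [set [set q.1.1; q.1.2] | q in X].

Lemma card_up_edges G v : #|up_edges G v| <= #|nbrs G v|.
Proof.
rewrite -(card_in_imset (f := fun q : Q => q.1.2)).
  apply: subset_leq_card; apply/subsetP => _ /imsetP[q + ->].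
  by rewrite !inE => /and5P[].
case=> [[a b] [c d]] [[a' b'] [c' d']]; rewrite !inE /=.
case/and5P=> /eqP-> _ _ /eqP-> /eqP->; case/and5P=> /eqP-> _ _ /eqP-> /eqP->.
by move=> ->.
Qed.

Lemma dst1P G v b : dst1 (plan_of G v) = Some b ->
  exists i, [/\ v \in vclass G i, b \in vclass G i & b = leader1 i (vclass G i) v].
Proof.
case E: (plan_of G v) => [m|] // H.
have va : v \in active G by rewrite -plan_of_active E.
have vi := active_vclass va; exists (degree_class (nbrs G v)).
move: H; rewrite -E (plan_ofE vi) => -[<-].
by split=> //; apply: block_leader_in.
Qed.

Lemma mem_edges1 G b q : q \in edges1 G b -> exists i v,
  [/\ v \in vclass G i, b \in vclass G i, b = leader1 i (vclass G i) v & q \in up_edges G v].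
Proof.
by case/bigcupP=> v /eqP/dst1P[i [vi bi E]] qv; exists i, v.
Qed.

Lemma labels_edges1 G i b : b \in vclass G i ->
  labels lab1 lab2 (edges1 G b) \subset high_labels G i.
Proof.
move=> bi; apply/subsetP => x; rewrite inE => xq.
suff H q : q \in edges1 G b -> (q.2.1 \in high_labels G i) && (q.2.2 \in high_labels G i).
  by case/orP: xq => /imsetP[q /H/andP[? ?] ->].
case/mem_edges1=> j [v [vj bj _]]; rewrite inE => /and5P[_ Gvu le_uv /eqP-> /eqP->].
have ij : i = j by rewrite -(vclass_class bi) (vclass_class bj).
have va := adj_active Gvu; rewrite adj_sym in Gvu; have ua := adj_active Gvu.
move: le_uv; rewrite (vclass_class vj) ij => le_uv.
by apply/andP; split; apply: imset_f; rewrite inE ?va ?ua ?(vclass_class vj) /=.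
Qed.

Lemma card_sparsify1 G i b : b \in vclass G i ->
  #|sparsify lab1 lab2 (edges1 G b)| <= #|high_labels G i|.
Proof.
move=> bi; apply: leq_trans (card_sparsify _ _ _) _.
exact: subset_leq_card (labels_edges1 bi).
Qed.

Lemma mem_edges2 G c q : q \in edges2 G c -> exists i b,
  [/\ b \in vclass G i, b \in leader1 i (vclass G i) @: vclass G i,
      c \in leader2 i (vclass G i) @: (leader1 i (vclass G i) @: vclass G i),
      c \in vclass G i & q \in edges1 G b].
Proof.
case/bigcupP=> b bc /(subsetP (sparsify_sub _ _ _)) qb.
have [i [v [vi bi bE qv]]] := mem_edges1 qb; exists i, b.
have bl : b \in leader1 i (vclass G i) @: vclass G i by rewrite bE imset_f.
move: bc; rewrite (plan_ofE bi) => /eqP[<-]; split=> //; first exact: imset_f.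
have : leader2 i (vclass G i) b \in leader1 i (vclass G i) @: vclass G i.
  exact: block_leader_in.
by case/imsetP=> w wi ->; apply: block_leader_in.
Qed.

Lemma card_sparsify2 G i c : c \in vclass G i ->
  #|sparsify lab1 lab2 (edges2 G c)| <= #|high_labels G i|.
Proof.
move=> ci; apply: leq_trans (card_sparsify _ _ _) _; apply: subset_leq_card.
apply/subsetP => x; rewrite inE.
have H q : q \in edges2 G c -> exists2 b, b \in vclass G i & q \in edges1 G b.
  case/mem_edges2=> j [b [bj _ _ cj qb]]; exists b => //.
  by rewrite -(vclass_class ci) (vclass_class cj).
by case/orP=> /imsetP[q /H[b bi qb] ->]; apply: (subsetP (labels_edges1 bi));
  rewrite inE imset_f ?orbT.
Qed.

(** A batch has at most [n %/ 4 ^ i + 1] vertices with fewer than [4 ^ i.+1] edges each, at most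
    [8 * n] in all as [4 ^ i <= n]. The common constant 40 is dictated by [load3]. *)
Lemma load1 G b :
  \sum_(v | dst1 (plan_of G v) == Some b) #|up_edges G v| <= 40 * n.
Proof.
have [v0 /eqP/dst1P[i [_ bi _]]|none] := pickP (fun v => dst1 (plan_of G v) == Some b); last first.
  by rewrite big_pred0.
pose W := [set v in vclass G i | leader1 i (vclass G i) v == b].
have sub v : dst1 (plan_of G v) == Some b -> v \in W.
  case/eqP/dst1P=> j [vj bj bE]; rewrite inE.
  by rewrite -(vclass_class bi) (vclass_class bj) vj -bE eqxx.
apply: (@leq_trans (\sum_(v in W) 4 ^ i.+1)).
  rewrite big_mkcond [X in _ <= X]big_mkcond; apply: leq_sum => v _.
  case: ifP => // /sub vW; rewrite vW; apply: leq_trans (card_up_edges _ _) _.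
  by move: vW; rewrite inE => /andP[/vclass_degree/andP[_ /ltnW]].
have cW : #|W| <= (n %/ 4 ^ i).+1 by apply: card_block.
rewrite sum_nat_const; apply: leq_trans (leq_mul cW (leqnn _)) _.
have := leq_trunc_div n (4 ^ i); have := vclass_le bi; rewrite expnS mulSn.
by rewrite mulnCA; lia.
Qed.

Lemma load2 G c :
  \sum_(b | dst2 (plan_of G b) == Some c) #|sparsify lab1 lab2 (edges1 G b)| <= 40 * n.
Proof.
(* [leader2] is meaningful on first leaders only; the other players hold no edges and contribute
   0. *)
pose ne b := edges1 G b != set0.
rewrite (bigID ne) /= [X in _ + X]big1 ?addn0 => [|b /andP[_]]; last first.
  rewrite negbK => /eqP b0; apply/eqP; rewrite cards_eq0 -subset0 -b0.
  exact: sparsify_sub.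
have H b : (dst2 (plan_of G b) == Some c) && ne b -> exists i,
  [/\ b \in vclass G i, b \in leader1 i (vclass G i) @: vclass G i,
      c = leader2 i (vclass G i) b & c \in vclass G i].
  case/andP=> bc /set0Pn[q /mem_edges1[i [v [vi bi bE _]]]]; exists i.
  have bl : b \in leader1 i (vclass G i) @: vclass G i by rewrite bE imset_f.
  move: bc; rewrite (plan_ofE bi) => /eqP[<-]; split=> //.
  have : leader2 i (vclass G i) b \in leader1 i (vclass G i) @: vclass G i.
    exact: block_leader_in.
  by case/imsetP=> w wi ->; apply: block_leader_in.
have [b0 /H[i [_ _ _ ci]]|none] :=
  pickP (fun b => (dst2 (plan_of G b) == Some c) && ne b); last first.
  by rewrite big_pred0.
pose W := [set b in leader1 i (vclass G i) @: vclass G i | leader2 i (vclass G i) b == c].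
apply: (@leq_trans (\sum_(b in W) #|high_labels G i|)).
  rewrite big_mkcond [X in _ <= X]big_mkcond; apply: leq_sum => b _.
  case: ifP => // /H[j [bj bl cE cj]].
  have ij : i = j by rewrite -(vclass_class ci) (vclass_class cj).
  subst j; rewrite inE bl -cE eqxx /=; exact: card_sparsify1.
have cW : #|W| <= 2 ^ i by apply: card_block; rewrite expn_gt0.
rewrite sum_nat_const; apply: leq_trans (leq_mul cW (leqnn _)) _.
by have := card_high_labels G i; lia.
Qed.

Lemma sum_vclass G : \sum_(i < L) #|vclass G i| <= n.
Proof.
under eq_bigr do rewrite -sum1_card.
rewrite (exchange_big_dep xpredT) //= -[X in _ <= X](card_ord n) -sum1_card.
apply: leq_sum => v _; rewrite sum1_card.
rewrite -(cards1 (degree_class (nbrs G v))); apply: subset_leq_card.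
by apply/subsetP => i; rewrite unfold_in /= => /vclass_class <-; rewrite inE.
Qed.

(** With [g] the first batch size, class [i] has at most [#|vclass G i| %/ (g * 2 ^ i) + 2] second
    leaders, each keeping at most [#|high_labels G i|] edges, itself at most [8 * g * 2 ^ i]. The
    quotients cost [8 * n] over all classes; the two additional leaders per class cost [32 * n] by
    geometric decay. *)
Lemma load3 G : \sum_c #|sparsify lab1 lab2 (edges2 G c)| <= 40 * n.
Proof.
pose W i := leader2 i (vclass G i) @: (leader1 i (vclass G i) @: vclass G i).
apply: (@leq_trans (\sum_c \sum_(i : 'I_L | c \in W i) #|high_labels G i|)).
  apply: leq_sum => c _; have [->|/set0Pn[q qc]] := eqVneq (edges2 G c) set0.
    suff -> : sparsify lab1 lab2 set0 = set0 by rewrite cards0.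
    by apply/eqP; rewrite -subset0 sparsify_sub.
  have [i [b [_ _ cW ci _]]] := mem_edges2 qc.
  by rewrite (bigD1 i) //=; apply: leq_trans (leq_addr _ _); apply: card_sparsify2.
rewrite (exchange_big_dep xpredT) //=.
apply: (@leq_trans (\sum_(i < L) (8 * #|vclass G i| + 2 * #|high_labels G i|))).
  apply: leq_sum => i _; rewrite sum_nat_const.
  set g := (n %/ 4 ^ i).+1; have g_gt0 : 0 < g by [].
  have p2 : 0 < 2 ^ i by rewrite expn_gt0.
  (* Each of the two roundings into blocks contributes 1. *)
  have cW : #|W i| <= #|vclass G i| %/ (g * 2 ^ i) + 2.
    apply: leq_trans (card_block_leaders _ p2) _.
    have /(leq_div2r (2 ^ i)) : #|leader1 i (vclass G i) @: vclass G i| <= #|vclass G i| %/ g + 1.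
      exact: card_block_leaders.
    rewrite -/g => H; apply: leq_trans (leq_add H (leqnn 1)) _.
    rewrite addn1 addn2 ltnS divnMA.
    apply: leq_trans (leq_div2r _ (leq_add (leqnn _) p2)) _.
    by rewrite divnDr ?dvdnn // divnn p2 addn1.
  apply: leq_trans (leq_mul cW (leqnn _)) _; rewrite mulnDl leq_add2r.
  have le_lab : #|high_labels G i| <= 8 * (g * 2 ^ i).
    rewrite -(leq_pmul2l p2); apply: leq_trans (card_high_labels G i) _.
    have : n <= g * 4 ^ i by rewrite ltnW // ltn_ceil // expn_gt0.
    by rewrite -[4]/(2 * 2) expnMn; lia.
  apply: leq_trans (leq_mul (leqnn _) le_lab) _.
  by have := leq_trunc_div #|vclass G i| (g * 2 ^ i); lia.
rewrite big_split -!big_distrr /=.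
have := sum_vclass G.
have := @sum_pow2_tail (fun j : nat => #|high_labels G j|) (8 * n) 0 L.
rewrite expn0 mul1n big_mkord => /(_ (fun j _ => card_high_labels G j)).
move: (\sum_(i < L) #|high_labels G i|) (\sum_(i < L) #|vclass G i|) => a b; lia.
Qed.

(** * Correctness of the collected edges *)

Lemma known_edges_sub G :
  known_edges (pointer G) (edges3 G) \subset edges G.
Proof.
apply/subsetP => A /setUP[] /imsetP[p + ->].
  by rewrite inE => /eqP/pointer_adj/mem_edges.
case/bigcupP=> c _ /(subsetP (sparsify_sub _ _ _)).
case/mem_edges2=> i [b [_ _ _ _ /mem_edges1[j [v [_ _ _]]]]].
by rewrite inE => /and5P[/eqP -> Gvu _ _ _]; apply: mem_edges.
Qed.

(** Connectivity is carried back from [edges3] to [edges2], then to [edges1], then to all edges,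
    undoing one sparsification at a time; an edge is treated at an end that owns it. *)
Lemma connect_known G v u :
  G v u -> connect (edge_rel (known_edges (pointer G) (edges3 G))) v u.
Proof.
set e := edge_rel _.
have e_sym : connect_sym e by apply: sym_connect_sym; apply: edge_rel_sym.
have valid (X : {set Q}) q : X \subset \bigcup_v up_edges G v -> q \in X ->
    [/\ G q.1.1 q.1.2, lab1 q = label G q.1.1 & lab2 q = label G q.1.2].
  move=> sX /(subsetP sX)/bigcupP[w _].
  by rewrite inE /lab1 /lab2 => /and5P[/eqP-> ? _ /eqP-> /eqP->].
have lab_connect x y : label G x = label G y -> connect e x y.
  move/rootP => H.
  have {H} := H (sym_connect_sym (@pointer_rel_sym (pointer G))).
  apply: connect_sub => {x y} x y xy.
  have ptr a b : pointer G a = Some b -> e a b.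
    move=> ab; apply/andP; split; first exact: adj_neq (pointer_adj ab).
    by apply/setUP; left; apply/imsetP; exists (a, b); rewrite ?inE ?ab.
  by case/orP: xy => /eqP/ptr/connect1; rewrite // e_sym.
(* Connectivity of the endpoints goes back through a local sparsification,
   since vertices with the same label are already connected. *)
have lift (X : {set Q}) : X \subset \bigcup_v up_edges G v ->
    (forall q, q \in sparsify lab1 lab2 X -> connect e q.1.1 q.1.2) ->
    forall q, q \in X -> connect e q.1.1 q.1.2.
  move=> sX cY q qX; have sY := subset_trans (sparsify_sub lab1 lab2 X) sX.
  have [_ q1 q2] := valid _ _ sX qX.
  have /connectP[p] := connect_sparsify lab1 lab2 qX.
  rewrite q1 q2; elim: p q.1.1 => [|x p IHp] a /=.
    by move=> _ /esym; apply: lab_connect.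
  case/andP=> /label_relP[r rY j] px lp.
  have [Gr r1 r2] := valid _ _ sY rY.
  have er := cY _ rY.
  case/orP: j => /andP[/eqP j1 /eqP j2].
    apply: (connect_trans (lab_connect a r.1.1 _)); first by rewrite -r1 j1.
    apply: connect_trans er _; apply: IHp; rewrite -r2 j2 //.
  apply: (connect_trans (lab_connect a r.1.2 _)); first by rewrite -r2 j2.
  rewrite e_sym in er; apply: connect_trans er _; apply: IHp; rewrite -r1 j1 //.
have s1 b : edges1 G b \subset \bigcup_v up_edges G v.
  by apply/bigcupsP => w _; apply: (bigcup_sup w).
have s2 c : edges2 G c \subset \bigcup_v up_edges G v.
  by apply/bigcupsP => b _; apply: subset_trans (sparsify_sub _ _ _) (s1 b).
have c3 q : q \in edges3 G -> connect e q.1.1 q.1.2.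
  move=> q3; apply: connect1; apply/andP; split.
    have [c _ /(subsetP (sparsify_sub _ _ _)) qc] := bigcupP q3.
    by have [/adj_neq] := valid _ _ (s2 c) qc.
  by apply/setUP; right; apply/imsetP; exists q.
have c2 c q : q \in edges2 G c -> connect e q.1.1 q.1.2.
  by apply: (lift _ (s2 c)) => r rc; apply: c3; apply/bigcupP; exists c.
have c1 b q : q \in edges1 G b -> connect e q.1.1 q.1.2.
  apply: (lift _ (s1 b)) => r rb.
  have /set0Pn[q0 /mem_edges1[i [w [_ bi _ _]]]] : edges1 G b != set0.
    by apply/set0Pn; exists r; apply: subsetP rb; apply: sparsify_sub.
  apply: (c2 (leader2 i (vclass G i) b)); apply/bigcupP; exists b => //.
  by rewrite (plan_ofE bi).
have cup x y : G x y -> degree_class (nbrs G x) <= degree_class (nbrs G y) -> connect e x y.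
  move=> Gxy le_xy; have xi := active_vclass (adj_active Gxy).
  set i := degree_class (nbrs G x) in xi.
  apply: (c1 (leader1 i (vclass G i) x) ((x, y), (label G x, label G y))).
  apply/bigcupP; exists x; first by rewrite (plan_ofE xi).
  by rewrite inE /= !eqxx Gxy le_xy.
move=> Gvu; have [/cup|/ltnW/cup] := leqP (degree_class (nbrs G v)) (degree_class (nbrs G u)).
  exact.
by rewrite e_sym; apply; rewrite adj_sym.
Qed.

(** * Message lengths *)

Lemma card_active G : #|active G| <= 2 * #|edges G|.
Proof.
apply: leq_trans (sum_degrees G); rewrite -sum1_card big_mkcond /=.
by apply: leq_sum => v _; rewrite inE -card_gt0; case: ltnP.
Qed.

(** Since [lg >= 1], also [L <= 2 * lg]. Each factor of a message type thus costs [2 * lg] bits, and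
    at most four factors occur, whence the constant 8. *)
Lemma message_sizes : 1 < n ->
  [/\ n <= 2 ^ (2 * lg), L <= 2 ^ (2 * lg) & 2 ^ L <= 2 ^ (2 * lg)].
Proof.
move=> n_gt1; have /andP[_ lt_n] := trunc_log_bounds (isT : 1 < 2) (isT : 0 < n).
have lg_gt0 : 0 < lg by rewrite lgE trunc_log_max.
have le_L : 2 ^ L <= 2 ^ (2 * lg) by rewrite leq_exp2l //; lia.
split=> //; first by apply: leq_trans le_L; rewrite ltnW // lgE.
by apply: leq_trans le_L; rewrite ltnW // ltn_expl.
Qed.

Lemma mul_pow2_le a b x y : a <= 2 ^ x -> b <= 2 ^ y -> a * b <= 2 ^ (x + y).
Proof. by move=> le_a le_b; rewrite expnD leq_mul. Qed.

Let fits (M : finType) := 1 < n -> #|M| <= 2 ^ (8 * trunc_log 2 n).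

Lemma fits_le (M : finType) (k : nat) :
  k <= 8 -> (1 < n -> #|M| <= 2 ^ (k * lg)) -> fits M.
Proof.
move=> le_k le_M /le_M; rewrite -lgE => H; apply: leq_trans H _.
by rewrite leq_exp2l // leq_mul2r le_k orbT.
Qed.

(** * The nine routed phases *)

Local Notation realized := (@realizes n 8 40).

(** Phase 1: a vertex of class [i] sends its class and one bit per seed of the recipient to at most
    [4 ^ i] players, no more than its degree. *)
Definition probe A (w : 'I_n) : option ('I_L * {ffun 'I_L -> bool}) :=
  let i := degree_class A in
  if (A != set0) && (w < 4 ^ i)
  then Some (i, [ffun l => [disjoint disp i (w, l) & A]]) else None.

Definition heard_class (s : {ffun 'I_n -> option ('I_L * {ffun 'I_L -> bool})}) i :
  {set 'I_n} := [set u | if s u is Some m then m.1 == i else false].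

Definition heard_missed (s : {ffun 'I_n -> option ('I_L * {ffun 'I_L -> bool})}) i l :
  {set 'I_n} := [set u | if s u is Some m then (m.1 == i) && m.2 l else false].

Lemma heard_classE G (v : 'I_n) i :
  heard_class [ffun u => probe (nbrs G u) v] i = if v < 4 ^ i then vclass G i else set0.
Proof.
apply/setP => u; rewrite inE ffunE /probe.
have [ui|] := boolP (u \in vclass G i).
  move: (ui); rewrite (vclass_class ui) inE => /andP[-> _] /=.
  by case: ltnP => _; rewrite ?eqxx ?ui ?in_set0.
move=> nui; have -> : (u \in if v < 4 ^ i then vclass G i else set0) = false.
  by case: ifP => _; rewrite ?in_set0 ?(negbTE nui).
by case: ifP => // /andP[ne _] /=; apply: contraNF nui => H; rewrite inE ne.
Qed.

Lemma heard_missedE G (v : 'I_n) i l : v < 4 ^ i ->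
  heard_missed [ffun u => probe (nbrs G u) v] i l = missed G i (v, l).
Proof.
move=> lt_v; apply/setP => u; rewrite [LHS]inE ffunE /probe [RHS]inE.
have [ui|] := boolP (u \in vclass G i).
  move: (ui); rewrite (vclass_class ui) inE => /andP[-> _] /=.
  by rewrite lt_v /= eqxx ffunE.
move=> nui; case: ifP => // /andP[ne _] /=.
by apply: contraNF nui => /andP[H _]; rewrite inE ne.
Qed.

(** Since [0 < 4 ^ i], player 0 learns every class, which lets it act as the coordinator. *)
Definition know1 G v :=
  (nbrs G v, ([ffun i => report G v i],
              [ffun i : 'I_L => if v < 4 ^ i then vclass G i else set0])).

Lemma realize1 : realized 1 know1 2.
Proof.
have H := @realizes_talk n 8 40 0 _ _ 0 2 _ (fun _ A w => probe A w) _ isT _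
  (realizes_init n 8 40).
pose post (v : 'I_n) (s : {set 'I_n} * {ffun 'I_n -> option ('I_L * {ffun 'I_L -> bool})}) :=
  (s.1, ([ffun i : 'I_L => if (heard_class s.2 i != set0) && (v < 4 ^ i) then
             [pick l | 2 ^ i * #|heard_missed s.2 i l| <= 2 * #|heard_class s.2 i|]
           else None],
         [ffun i : 'I_L => heard_class s.2 i])).
apply: (realizes_map (f := post)) (H _ _) => [G v||G]; last first.
- apply: leq_trans (sum_degrees G); apply: leq_sum => u _.
  have [u0|ne] := eqVneq (nbrs G u) set0.
    rewrite (_ : [set _ | _] = set0) ?cards0 //.
    by apply/setP => w; rewrite !inE /probe u0 eqxx.
  have /andP[le_deg _] := degree_classP ne; apply: leq_trans le_deg.
  set k := 4 ^ _; apply: (@leq_trans #|[set w : 'I_n | w < k]|).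
    apply: subset_leq_card; apply/subsetP => w; rewrite !inE /probe ne /= -/k.
    by case: ifP.
  by rewrite card_ord_lt geq_minl.
- apply: (@fits_le _ 4) => // /message_sizes[_ le_L le_2L].
  rewrite card_prod card_ffun card_bool !card_ord -[4 * lg]/((2 + 2) * lg) mulnDl.
  exact: mul_pow2_le.
rewrite /know1; congr (_, (_, _)).

  apply/ffunP => i; rewrite !ffunE /= heard_classE /report.
  case: ltnP => [lt_v|_]; rewrite ?andbT ?andbF ?eqxx //=; case: ifP => // _.
  by apply: eq_pick => l; rewrite heard_missedE.
by apply/ffunP => i; rewrite !ffunE /= heard_classE.
Qed.

Lemma sum_cond_le (P : pred 'I_n) (F : 'I_n -> nat) :
  \sum_(u | P u) F u <= \sum_u F u.
Proof. by rewrite big_mkcond; apply: leq_sum => u _; case: ifP. Qed.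

Lemma sum_pow4_bounded (m k : nat) : 0 < k -> \sum_(i < m | 4 ^ i <= k) 4 ^ i <= 4 * k.
Proof.
move=> k_gt0; elim: m => [|m IHm]; first by rewrite big_ord0.
rewrite big_mkcond big_ord_recr -big_mkcond /=; case: ifP => [le_m|_]; last by rewrite addn0.
apply: leq_trans (leq_mul (leqnn 4) le_m); rewrite -expnS.
apply: leq_trans (sum_pow4 _); rewrite big_ord_recr /= leq_add2r.
by rewrite big_mkcond; apply: leq_sum => i _; case: ifP.
Qed.

Definition reports (u : 'I_n) (rep : {ffun 'I_L -> option 'I_L}) :
  {set 'I_n * ('I_L * 'I_L)} := [set m | (m.1 == u) && (rep m.2.1 == Some m.2.2)].

Lemma sum_reports G :
  \sum_u #|reports u [ffun i => report G u i]| <= \sum_(i < L | vclass G i != set0) 4 ^ i.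
Proof.
apply: (@leq_trans (\sum_(u < n) \sum_(i < L | (vclass G i != set0) && (u < 4 ^ i)) 1)).
  apply: leq_sum => u _; rewrite sum1_card.
  rewrite -(card_in_imset (f := fun m : 'I_n * ('I_L * 'I_L) => m.2.1)).
    apply: subset_leq_card; apply/subsetP => _ /imsetP[m + ->].
    by rewrite inE ffunE /report unfold_in /= => /andP[_]; case: ifP.
  case=> [a [i l]] [b [j l']]; rewrite !inE !ffunE /=.
  by case/andP=> /eqP-> /eqP ri /andP[/eqP-> /eqP rj] ij; move: ri; rewrite ij rj => -[->].
rewrite (exchange_big_dep (fun i => vclass G i != set0)) /= => [|u i _ /andP[] //].
apply: leq_sum => i ne; apply: (@leq_trans #|[set u : 'I_n | u < 4 ^ i]|).
  by rewrite sum1_card subset_leq_card //; apply/subsetP => u; rewrite unfold_in !inE => /andP[].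
by rewrite card_ord_lt geq_minl.
Qed.

Definition coordinator T (v : 'I_n) (x y : T) : T := if v == ord0 then x else y.

Definition know2 G v :=
  (nbrs G v, coordinator v
    (Some ([ffun i => vclass G i], [ffun i => seed G i])) None).

(** Phase 2: good seeds go to the coordinator. An inhabited class costs at most [4 ^ i] messages,
    which the degree of one of its vertices pays for; as [4 ^ i <= n], the geometric sum bounds the
    load by [4 * n]. *)
Lemma realize2 : realized 2 know2 4.
Proof.
pose K := ({set 'I_n} * ({ffun 'I_L -> option 'I_L} * {ffun 'I_L -> {set 'I_n}}))%type.
have H := @realizes_gather n 8 40 _ _ _ _ 2 _ (fun _ _ => Some ord0)
  (fun u (s : K) => reports u s.2.1) _ _ _ realize1.
pose post (v : 'I_n) (s : K * {set 'I_n * ('I_L * 'I_L)}) :=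
  (s.1.1, coordinator v
    (Some (s.1.2.2, [ffun i => [pick p : 'I_n * 'I_L | (p.1, (i, p.2)) \in s.2]])) None).
apply: (realizes_map (f := post)) (H _ _ _) => [G v||G w|G].
- rewrite /post /know2 /coordinator /=; case: eqP => // ->; congr (_, Some (_, _)).
    by apply/ffunP => i; rewrite !ffunE expn_gt0.
  apply/ffunP => i; rewrite !ffunE; apply: eq_pick => p.
  apply/bigcupP/idP => [[u _]|rp].
    by rewrite inE ffunE /= => /andP[/eqP->].
  by exists p.1; rewrite // inE ffunE /= eqxx.
- apply: (@fits_le _ 6) => // /message_sizes[le_n le_L _].
  rewrite !card_prod !card_ord -[6 * lg]/((2 + (2 + 2)) * lg) !mulnDl.
  by rewrite !mul_pow2_le.
- apply: leq_trans (sum_cond_le _ _) _; apply: leq_trans (sum_reports G) _.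
  apply: leq_trans (_ : 4 * n <= _); last by rewrite leq_mul2r orbT.
  apply: leq_trans (sum_pow4_bounded L (isT : 0 < n)).
  rewrite big_mkcond [X in _ <= X]big_mkcond; apply: leq_sum => i _.
  by case: ifP => // /set0Pn[v /vclass_le ->].
apply: leq_trans (sum_reports G) (leq_trans _ (sum_degrees G)).
apply: (@leq_trans (\sum_(i < L) \sum_(v in vclass G i) #|nbrs G v|)).
  rewrite big_mkcond; apply: leq_sum => i _; case: ifP => // /set0Pn[v vi].
  rewrite (bigD1 v) //=; apply: leq_trans (leq_addr _ _).
  by case/andP: (vclass_degree vi).
rewrite (exchange_big_dep xpredT) //=; apply: leq_sum => v _.
have [va|va] := boolP (v \in active G).
  rewrite (big_pred1 (degree_class (nbrs G v))) // => i.
  by apply/idP/eqP => [/vclass_class|->]; last exact: active_vclass.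
by rewrite big_pred0 // => i; apply: contraNF va; rewrite !inE => /andP[].
Qed.

Definition know3 G v := (nbrs G v, plan_of G v, coordinator v (active G) set0).

(** Phase 3: the coordinator sends their plans to the non-isolated vertices, of which there are at
    most twice as many as edges. *)
Lemma realize3 : realized 3 know3 6.
Proof.
pose K := ({set 'I_n} *
  option ({ffun 'I_L -> {set 'I_n}} * {ffun 'I_L -> option ('I_n * 'I_L)}))%type.
have H := @realizes_talk n 8 40 _ _ _ _ 2 _
  (fun _ (s : K) w => if s.2 is Some c then plan c.1 c.2 w else None) _ isT _ realize2.
pose post (v : 'I_n) (s : K * {ffun 'I_n -> option (('I_n * 'I_L) * ('I_n * 'I_n))}) :=
  (s.1.1, s.2 ord0, if s.1.2 is Some c then [set w | [exists i, w \in c.1 i]] else set0).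
apply: (realizes_map (f := post)) (H _ _) => [G v||G].
- rewrite /post /know3 /= ffunE /=; congr (_, _, _); rewrite /coordinator; case: eqP => // _.
  apply/setP => w; rewrite [LHS]inE; apply/existsP/idP => [[i]|/active_vclass wi].
    by rewrite ffunE !inE => /andP[].
  by exists (degree_class (nbrs G w)); rewrite ffunE.
- apply: (@fits_le _ 8) => // /message_sizes[le_n le_L _].
  rewrite !card_prod !card_ord -[8 * lg]/(((2 + 2) + (2 + 2)) * lg) !mulnDl.
  by rewrite !mul_pow2_le.
apply: leq_trans (card_active G); rewrite (bigD1 ord0) //= big1 ?addn0 => [|u u0]; last first.
  rewrite /coordinator (negbTE u0); apply/eqP; rewrite cards_eq0; apply/eqP/setP => w.
  by rewrite !inE.
by rewrite subset_leq_card //; apply/subsetP => w; rewrite [_ \in [set _ | _]]inE plan_of_active.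
Qed.

Definition know4 G v :=
  (nbrs G v, plan_of G v, coordinator v (active G, pointer G) (set0, [ffun=> None])).

(** Phase 4: pointers, computed locally from the plans, return to the coordinator, at most one per
    non-isolated vertex. *)
Lemma realize4 : realized 4 know4 8.
Proof.
pose K := ({set 'I_n} * option (('I_n * 'I_L) * ('I_n * 'I_n)) * {set 'I_n})%type.
have H := @realizes_gather n 8 40 _ _ _ _ 2 _ (fun _ _ => Some ord0)
  (fun u (s : K) => [set m : 'I_n * 'I_n | (m.1 == u) && (local_pointer s.1.1 s.1.2 == Some m.2)])
  _ _ _ realize3.
pose post (v : 'I_n) (s : K * {set 'I_n * 'I_n}) :=
  (s.1.1.1, s.1.1.2, coordinator v
    (s.1.2, [ffun u => [pick w | (u, w) \in s.2]]) (set0, [ffun=> None])).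
have single G u : #|[set m : 'I_n * 'I_n | (m.1 == u) &&
      (local_pointer (nbrs G u) (plan_of G u) == Some m.2)]| <= (u \in active G).
  case E: (local_pointer _ _) => [w|]; last first.
    by rewrite (_ : [set _ | _] = set0) ?cards0 //; apply/setP => m; rewrite !inE andbF.
  have -> : u \in active G by apply: (@adj_active G _ w); apply: pointer_adj; rewrite ffunE.
  apply: (@leq_trans #|[set (u, w)]|); last by rewrite cards1.
  apply: subset_leq_card; apply/subsetP => -[a b].
  by rewrite !inE /= => /andP[/eqP-> /eqP[->]].
have tot G : \sum_u #|[set m : 'I_n * 'I_n | (m.1 == u) &&
      (local_pointer (nbrs G u) (plan_of G u) == Some m.2)]| <= #|active G|.
  rewrite -sum1_card [X in _ <= X]big_mkcond; apply: leq_sum => u _.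
  by apply: leq_trans (single G u) _; case: (u \in active G).
apply: (realizes_map (f := post)) (H _ _ _) => [G v||G w|G].
- rewrite /post /know4 /coordinator /=; case: eqP => // ->; congr (_, _, (_, _)).
  apply/ffunP => u; rewrite !ffunE.
  have E w : ((u, w) \in \bigcup_(a | Some ord0 == Some (ord0 : 'I_n))
     [set m : 'I_n * 'I_n | (m.1 == a) && (local_pointer (nbrs G a) (plan_of G a) == Some m.2)])
     = (local_pointer (nbrs G u) (plan_of G u) == Some w).
    apply/bigcupP/idP => [[a _]|uw]; first by rewrite inE /= => /andP[/eqP->].
    by exists u; rewrite // inE /= eqxx.
  rewrite (eq_pick E); case: (local_pointer _ _) => [w|].
    by case: pickP => [w' /eqP[->] //|/(_ w)]; rewrite eqxx.
  by case: pickP.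
- apply: (@fits_le _ 4) => // /message_sizes[le_n _ _].
  by rewrite card_prod card_ord -[4 * lg]/((2 + 2) * lg) mulnDl mul_pow2_le.
- apply: leq_trans (sum_cond_le _ _) _; apply: leq_trans (tot G) _.
  by apply: leq_trans (card_set_ord _) _; rewrite leq_pmull.
exact: leq_trans (tot G) (card_active G).
Qed.

Definition own_label G v := if v \in active G then Some (label G v) else None.

Definition know5 G v :=
  (nbrs G v, plan_of G v, own_label G v, coordinator v (pointer G) [ffun=> None]).

(** Phase 5: the coordinator contracts the pointers and tells each non-isolated vertex its
    supernode. *)
Lemma realize5 : realized 5 know5 10.
Proof.
pose K := ({set 'I_n} * option (('I_n * 'I_L) * ('I_n * 'I_n)) *
  ({set 'I_n} * {ffun 'I_n -> option 'I_n}))%type.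
have H := @realizes_talk n 8 40 _ _ _ _ 2 _
  (fun _ (s : K) w => if w \in s.2.1 then Some (root (pointer_rel s.2.2) w) else None)
  _ isT _ realize4.
pose post (v : 'I_n) (s : K * {ffun 'I_n -> option 'I_n}) :=
  (s.1.1.1, s.1.1.2, s.2 ord0, s.1.2.2).
apply: (realizes_map (f := post)) (H _ _) => [G v||G].
- rewrite /post /know5 /= ffunE /=; congr (_, _, _, _).
  by rewrite /coordinator; case: eqP.
- apply: (@fits_le _ 2) => // /message_sizes[le_n _ _].
  by rewrite card_ord.
apply: leq_trans (card_active G); rewrite (bigD1 ord0) //= big1 ?addn0 => [|u u0]; last first.
  rewrite /coordinator (negbTE u0); apply/eqP; rewrite cards_eq0; apply/eqP/setP => w.
  by rewrite !inE.
rewrite subset_leq_card //; apply/subsetP => w; rewrite [_ \in [set _ | _]]inE /=.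
by case: ifP.
Qed.

Definition know6 G v := (plan_of G v, up_edges G v, coordinator v (pointer G) [ffun=> None]).

(** Phase 6: neighbours exchange class and label, after which each vertex knows the edges it
    owns. *)
Lemma realize6 : realized 6 know6 12.
Proof.
pose K := ({set 'I_n} * option (('I_n * 'I_L) * ('I_n * 'I_n)) * option 'I_n *
  {ffun 'I_n -> option 'I_n})%type.
have H := @realizes_talk n 8 40 _ _ _ _ 2 _
  (fun _ (s : K) w => if w \in s.1.1.1 then omap (pair (degree_class s.1.1.1)) s.1.2 else None)
  _ isT _ realize5.
pose post (v : 'I_n) (s : K * {ffun 'I_n -> option ('I_L * 'I_n)}) :=
  (s.1.1.1.2, [set q : Q | (q.1.1 == v) && (s.1.1.2 == Some q.2.1) &&
     if s.2 q.1.2 is Some m then (degree_class s.1.1.1.1 <= m.1) && (q.2.2 == m.2) else false],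
   s.1.2).
apply: (realizes_map (f := post)) (H _ _) => [G v||G].
- rewrite /post /know6 /=; congr (_, _, _); apply/setP => q; rewrite [LHS]inE [RHS]inE ffunE /=.
  rewrite inE adj_sym; have [Gvu|] := boolP (G v q.1.2); last by rewrite !andbF.
  have va := adj_active Gvu; rewrite adj_sym in Gvu; have ua := adj_active Gvu.
  rewrite /own_label va ua /= [q.2.1 == _]eq_sym [RHS]/=.
  rewrite (_ : (Some (label G v) == Some q.2.1) = (label G v == q.2.1)) //.
  by rewrite -andbA; congr (_ && _); rewrite andbCA.
- apply: (@fits_le _ 4) => // /message_sizes[le_n le_L _].
  by rewrite card_prod !card_ord -[4 * lg]/((2 + 2) * lg) mulnDl mul_pow2_le.
apply: leq_trans (sum_degrees G); apply: leq_sum => u _; rewrite subset_leq_card //.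
by apply/subsetP => w; rewrite [_ \in [set _ | _]]inE /=; case: ifP.
Qed.

Lemma fits_Q : fits Q.
Proof.
apply: (@fits_le _ 8) => // /message_sizes[le_n _ _].
rewrite !card_prod !card_ord -[8 * lg]/(((2 + 2) + (2 + 2)) * lg) !mulnDl.
by rewrite !mul_pow2_le.
Qed.

Lemma sum_up_edges G : \sum_v #|up_edges G v| <= 2 * #|edges G|.
Proof.
by apply: leq_trans (sum_degrees G); apply: leq_sum => v _; apply: card_up_edges.
Qed.

Lemma sum_edges1 G : \sum_b #|sparsify lab1 lab2 (edges1 G b)| <= 2 * #|edges G|.
Proof.
apply: leq_trans (sum_up_edges G); apply: leq_trans (sum_card_bigcup _ _).
by apply: leq_sum => b _; apply: subset_leq_card; apply: sparsify_sub.
Qed.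

Lemma sum_edges2 G : \sum_c #|sparsify lab1 lab2 (edges2 G c)| <= 2 * #|edges G|.
Proof.
apply: leq_trans (sum_edges1 G); apply: leq_trans (sum_card_bigcup _ _).
by apply: leq_sum => c _; apply: subset_leq_card; apply: sparsify_sub.
Qed.

Let K7 := (option (('I_n * 'I_L) * ('I_n * 'I_n)) * {set Q} *
  {ffun 'I_n -> option 'I_n})%type.

Definition know7 G v : K7 := (plan_of G v, edges1 G v, coordinator v (pointer G) [ffun=> None]).

(** Phases 7 to 9 gather edges at the first leaders, the second leaders and the coordinator,
    sparsifying before the last two. *)
Lemma realize7 : realized 7 know7 14.
Proof.
have H := @realizes_gather n 8 40 _ K7 know6 _ 2 _ (fun _ s => dst1 s.1.1)
  (fun _ s => s.1.2) fits_Q load1 sum_up_edges realize6.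
exact: (realizes_map (f := fun _ s => (s.1.1.1, s.2, s.1.2))) H.
Qed.

Definition know8 G v := (edges2 G v, coordinator v (pointer G) [ffun=> None]).

Lemma realize8 : realized 8 know8 16.
Proof.
have H := @realizes_gather n 8 40 _ K7 know7 _ 2 _ (fun _ s => dst2 s.1.1)
  (fun _ s => sparsify lab1 lab2 s.1.2) fits_Q load2 sum_edges1 realize7.
exact: (realizes_map (f := fun _ s => (s.2, s.1.2))) H.
Qed.

Definition forest_of G := min_forest (known_edges (pointer G) (edges3 G)).

Lemma realize9 : realized 9 (fun G v => coordinator v (Some (forest_of G)) None) 18.
Proof.
have H := @realizes_gather n 8 40 _ _ know8 _ 2 _ (fun _ _ => Some ord0)
  (fun _ s => sparsify lab1 lab2 s.1)
  fits_Q (fun G w => leq_trans (sum_cond_le _ _) (load3 G)) sum_edges2 realize8.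
apply: (realizes_map (f := fun v s => coordinator v
  (Some (min_forest (known_edges s.1.2 s.2))) None)) H => G v.
by rewrite /coordinator; case: eqP => // ->.
Qed.

Lemma forest_of_spanning G : spanning_forest G (forest_of G).
Proof.
by apply: min_forest_spanning; [apply: known_edges_sub | apply: connect_known].
Qed.

End Algorithm.

(** * Assembly of the algorithm *)

Definition with_output (n B C K a : nat)
    (x : sgraph n -> 'I_n -> option {set {set 'I_n}}) (rx : realizes B C K x a) :
    algorithm n :=
  let P := projT1 rx in
  @Algorithm n (state P) (init P) (schedule P) (@send n P) (@receive n P)
    (sval (projT2 rx)).

Lemma with_outputP (n B C K a : nat)
    (x : sgraph n -> 'I_n -> option {set {set 'I_n}}) (rx : realizes B C K x a) :
  [/\ schedule (with_output rx) = nseq K Route,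
      forall G v, final_output (with_output rx) G v = x G v,
      forall G k, k < K -> admissible (with_output rx) G B C k
    & forall G, communication (with_output rx) G <= a * #|edges G|].
Proof.
case: rx => P [dec [sP decP adm com]]; split=> // G v.
rewrite /final_output [size _](_ : _ = K); first exact: decP.
by rewrite /= sP size_nseq.
Qed.

Definition forest_algorithm (n : nat) : algorithm n :=
  match n with
  | 0 => with_output (realizes_map (f := fun _ _ => None) (fun _ _ => erefl)
           (realizes_init 0 0 0))
  | n0.+1 => with_output (realize9 (erefl (trunc_log 2 n0.+1)))
  end.

Theorem theorem2 :
  exists (P : forall n : nat, algorithm n) (B C A : nat),
    (forall lenzen : nat -> nat,
       exists R : nat, forall n : nat, 0 < n -> rounds lenzen C (P n) <= R) /\
    (forall n : nat, 0 < n -> forall G : sgraph n,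
       [/\ forall k : nat, k < size (schedule (P n)) ->
             admissible (P n) G B C k,
           solves_spanning_forest (P n) G
         & communication (P n) G <= A * #|edges G|]).
Proof.
(* Messages of [8 * trunc_log 2 n] bits, loads of at most [40 * n], and nine phases with at most two
   messages per edge each. *)
exists forest_algorithm, 8, 40, 18; split=> [lenzen|[//|n0] _ G].
  exists (9 * lenzen 40) => -[//|n0] _; rewrite /rounds /forest_algorithm.
  case: (with_outputP (realize9 (erefl (trunc_log 2 n0.+1)))) => -> _ _ _.
  by rewrite big_nseq iter_addn_0 mulnC.
rewrite /forest_algorithm.
case: (with_outputP (realize9 (erefl (trunc_log 2 n0.+1)))) => sP outP adm com.
split=> [k||//]; first by rewrite sP size_nseq; apply: adm.
split=> [|v F]; first by exists ord0, (forest_of (trunc_log 2 n0.+1) G); rewrite outP.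
rewrite outP /coordinator; case: ifP => // _ [<-].
exact: forest_of_spanning.
Qed.
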